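(* Let $H$ be a separable infinite dimensional complex Hilbert space and let $L(H)$ be the C*-algebra of bounded linear operators on $H$. Assume the Continuum Hypothesis. Then the isomorphism type of $F_{\mathcal{V}}(L(H))$ depends on the choice of the nonprincipal ultrafilter $\mathcal{V}$ on $\mathbb{N}$; that is, there exist nonprincipal ultrafilters $\mathcal{U}$ and $\mathcal{V}$ on $\mathbb{N}$ such that $F_{\mathcal{U}}(L(H))$ and $F_{\mathcal{V}}(L(H))$ are not isomorphic.
   Context: For a C*-algebra $A$ and an ultrafilter $\mathcal{V}$ on $\mathbb{N} = \{0,1,2,\dots\}$, let $\ell^\infty(A)$ be the C*-algebra of all norm-bounded sequences in $A$, let $c_{\mathcal{V}}(A) = \{(a_n) \in \ell^\infty(A) : \lim_{n\to\mathcal{V}} \|a_n\| = 0\}$ (a norm-closed two-sided ideal), and let $A^{\mathcal{V}} = \ell^\infty(A)/c_{\mathcal{V}}(A)$ be the (norm) ultrapower. $A$ is identified with the image in $A^{\mathcal{V}}$ of the constant sequences. For $A \subseteq B$, $A' \cap B = \{b \in B : ab = ba \text{ for all } a \in A\}$. $F_{\mathcal{V}}(A)$ is the quotient of $A' \cap A^{\mathcal{V}}$ by the annihilator $\{b \in A^{\mathcal{V}} : ba = 0 \text{ for all } a \in A\}$; if $A$ is unital the annihilator is trivial and $F_{\mathcal{V}}(A) = A' \cap A^{\mathcal{V}}$. Isomorphism means isomorphism of C*-algebras. *)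

(* Defs.v *)
From HB Require Import structures.
From mathcomp Require Import all_boot all_order all_algebra.
From mathcomp Require Import generic_quotient ring_quotient sesquilinear complex.
From mathcomp Require Import boolp classical_sets functions cardinality filter.
From mathcomp Require Import reals topology normedtype.
From mathcomp Require Import ring lra.
Set Implicit Arguments.
Unset Strict Implicit.
Unset Printing Implicit Defensive.
Import Order.TTheory GRing.Theory Num.Theory.
Import numFieldNormedType.Exports.
Local Open Scope classical_set_scope.
Local Open Scope ring_scope.
Local Open Scope quotient_scope.

Reserved Notation "x ** y" (at level 40, left associativity).

(* Not necessarily unital: MathComp's ring structures all have a unit. *)
HB.mixin Record isStarAlgebra (C : numClosedFieldType) A
    of GRing.Lmodule C A := {
  smul : A -> A -> A;
  star : A -> A;
  smulA : associative smul;
  smulDl : left_distributive smul +%R;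
  smulDr : right_distributive smul +%R;
  smulZl : forall (c : C) x y, smul (c *: x) y = c *: smul x y;
  smulZr : forall (c : C) x y, smul x (c *: y) = c *: smul x y;
  starK : involutive star;
  starD : {morph star : x y / x + y};
  starZ : forall (c : C) x, star (c *: x) = c^* *: star x;
  starM : forall x y, star (smul x y) = smul (star y) (star x)
}.

#[short(type="starAlgType")]
HB.structure Definition StarAlgebra (C : numClosedFieldType) :=
  {A of GRing.Lmodule C A & isStarAlgebra C A}.

Notation "x ** y" := (smul x y) : ring_scope.

Section StarAlgebraTheory.
Variables (C : numClosedFieldType) (A : starAlgType C).
Implicit Types x y z : A.

Lemma smul0l x : 0 ** x = 0 :> A.
Proof. by rewrite -(scale0r (0 : A)) smulZl !scale0r. Qed.

Lemma smul0r x : x ** 0 = 0 :> A.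
Proof. by rewrite -(scale0r (0 : A)) smulZr !scale0r. Qed.

Lemma smulNl x y : (- x) ** y = - (x ** y).
Proof. by rewrite -scaleN1r smulZl scaleN1r. Qed.

Lemma smulNr x y : x ** (- y) = - (x ** y).
Proof. by rewrite -scaleN1r smulZr scaleN1r. Qed.

Lemma smulBl x y z : (x - y) ** z = x ** z - y ** z.
Proof. by rewrite smulDl smulNl. Qed.

Lemma smulBr x y z : z ** (x - y) = z ** x - z ** y.
Proof. by rewrite smulDr smulNr. Qed.

Lemma star0 : star 0 = 0 :> A.
Proof. by rewrite -(scale0r (0 : A)) starZ rmorph0 !scale0r. Qed.

Lemma starN x : star (- x) = - star x.
Proof. by rewrite -scaleN1r starZ rmorphN1 scaleN1r. Qed.

Lemma starB x y : star (x - y) = star x - star y.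
Proof. by rewrite starD starN. Qed.

End StarAlgebraTheory.

(* For C*-algebras such an f is automatically isometric, hence this is
   isomorphism of C*-algebras. *)
Definition star_isomorphic (C : numClosedFieldType) (A B : starAlgType C) :=
  exists f : A -> B, [/\ bijective f, linear f,
    {morph f : x y / x ** y} & {morph f : x / star x}].

Section FunctionStarAlgebra.
Variables (C : numClosedFieldType) (I : Type) (A : starAlgType C).
Implicit Types f g h : I -> A.

Let fmul f g : I -> A := fun i => f i ** g i.
Let fstar f : I -> A := fun i => star (f i).

Let fmulA : associative fmul.
Proof. by move=> f g h; apply/funext => i; exact: smulA. Qed.
Let fmulDl : left_distributive fmul +%R.
Proof. by move=> f g h; apply/funext => i; exact: smulDl. Qed.
Let fmulDr : right_distributive fmul +%R.
Proof. by move=> f g h; apply/funext => i; exact: smulDr. Qed.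
Let fmulZl (c : C) f g : fmul (c *: f) g = c *: fmul f g.
Proof. by apply/funext => i; exact: smulZl. Qed.
Let fmulZr (c : C) f g : fmul f (c *: g) = c *: fmul f g.
Proof. by apply/funext => i; exact: smulZr. Qed.
Let fstarK : involutive fstar.
Proof. by move=> f; apply/funext => i; exact: starK. Qed.
Let fstarD : {morph fstar : f g / f + g}.
Proof. by move=> f g; apply/funext => i; exact: starD. Qed.
Let fstarZ (c : C) f : fstar (c *: f) = c^* *: fstar f.
Proof. by apply/funext => i; exact: starZ. Qed.
Let fstarM f g : fstar (fmul f g) = fmul (fstar g) (fstar f).
Proof. by apply/funext => i; exact: starM. Qed.

HB.instance Definition _ := isStarAlgebra.Build C (I -> A) fmulA fmulDl fmulDr
  fmulZl fmulZr fstarK fstarD fstarZ fstarM.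

End FunctionStarAlgebra.

Record starSubalg (C : numClosedFieldType) (A : starAlgType C) := StarSubalg {
  subalg_set :> A -> Prop;
  subalg0 : subalg_set 0;
  subalgD : forall (c : C) x y,
    subalg_set x -> subalg_set y -> subalg_set (c *: x + y);
  subalgM : forall x y, subalg_set x -> subalg_set y -> subalg_set (x ** y);
  subalgS : forall x, subalg_set x -> subalg_set (star x) }.

Section StarSubalgebra.
Variables (C : numClosedFieldType) (A : starAlgType C) (B : starSubalg A).

Definition in_subalg : {pred A} := fun x => `[< B x >].

Lemma in_subalgE x : (x \in in_subalg) = `[< B x >]. Proof. by []. Qed.

Let in_subalg_submod : submod_closed in_subalg.
Proof.
split; first exact/asboolP/subalg0.
by move=> c x y /asboolP Bx /asboolP By; apply/asboolP/subalgD.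
Qed.

HB.instance Definition _ := GRing.isSubmodClosed.Build C A in_subalg
  in_subalg_submod.

Record subalg := Subalg { subalg_val : A; subalg_valP : subalg_val \in in_subalg }.

HB.instance Definition _ := [isSub for subalg_val].
HB.instance Definition _ := [Choice of subalg by <:].
HB.instance Definition _ := [SubChoice_isSubLmodule of subalg by <:].

Implicit Types x y z : subalg.

Lemma subalgP x : B (subalg_val x).
Proof. by case: x => x /= /asboolP. Qed.

Definition to_subalg (a : A) (Ba : B a) : subalg := Subalg (asboolT Ba).

Let bmul x y := to_subalg (subalgM (subalgP x) (subalgP y)).
Let bstar x := to_subalg (subalgS (subalgP x)).

Let bmulA : associative bmul.
Proof. by move=> x y z; apply/val_inj; exact: smulA. Qed.
Let bmulDl : left_distributive bmul +%R.
Proof. by move=> x y z; apply/val_inj; exact: smulDl. Qed.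
Let bmulDr : right_distributive bmul +%R.
Proof. by move=> x y z; apply/val_inj; exact: smulDr. Qed.
Let bmulZl (c : C) x y : bmul (c *: x) y = c *: bmul x y.
Proof. by apply/val_inj; exact: smulZl. Qed.
Let bmulZr (c : C) x y : bmul x (c *: y) = c *: bmul x y.
Proof. by apply/val_inj; exact: smulZr. Qed.
Let bstarK : involutive bstar.
Proof. by move=> x; apply/val_inj; exact: starK. Qed.
Let bstarD : {morph bstar : x y / x + y}.
Proof. by move=> x y; apply/val_inj; exact: starD. Qed.
Let bstarZ (c : C) x : bstar (c *: x) = c^* *: bstar x.
Proof. by apply/val_inj; exact: starZ. Qed.
Let bstarM x y : bstar (bmul x y) = bmul (bstar y) (bstar x).
Proof. by apply/val_inj; exact: starM. Qed.

HB.instance Definition _ := isStarAlgebra.Build C subalg bmulA bmulDl bmulDr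
  bmulZl bmulZr bstarK bstarD bstarZ bstarM.

End StarSubalgebra.

Record starIdeal (C : numClosedFieldType) (A : starAlgType C) := StarIdeal {
  ideal_set :> A -> Prop;
  ideal0 : ideal_set 0;
  idealD : forall (c : C) x y,
    ideal_set x -> ideal_set y -> ideal_set (c *: x + y);
  idealMl : forall a x, ideal_set x -> ideal_set (a ** x);
  idealMr : forall a x, ideal_set x -> ideal_set (x ** a);
  idealS : forall x, ideal_set x -> ideal_set (star x) }.

Section StarQuotient.
Variables (C : numClosedFieldType) (A : starAlgType C) (J : starIdeal A).

Definition in_ideal : {pred A} := fun x => `[< J x >].

Let in_ideal_submod : submod_closed in_ideal.
Proof.
split; first exact/asboolP/ideal0.
by move=> c x y /asboolP Jx /asboolP Jy; apply/asboolP/idealD.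
Qed.

HB.instance Definition _ := GRing.isSubmodClosed.Build C A in_ideal
  in_ideal_submod.

Definition star_quot := Quotient.quot in_ideal.

HB.instance Definition _ := GRing.Zmodule.on star_quot.
HB.instance Definition _ :=
  EqQuotient.copy star_quot (Quotient.quot in_ideal).

Definition quot_pi (a : A) : star_quot := \pi_star_quot a.

Lemma quot_piP a b : quot_pi a = quot_pi b <-> J (a - b).
Proof.
split=> [/eqP|Jab]; first by rewrite /quot_pi -Quotient.idealrBE => /asboolP.
by apply/eqP; rewrite /quot_pi -Quotient.idealrBE; exact/asboolP.
Qed.

Lemma quot_piK (x : star_quot) : quot_pi (repr x) = x.
Proof. exact: reprK. Qed.

Lemma quot_pi_surj (x : star_quot) : exists a, quot_pi a = x.
Proof. by exists (repr x); exact: quot_piK. Qed.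

Lemma quot_piD a b : quot_pi (a + b) = quot_pi a + quot_pi b.
Proof. by rewrite /quot_pi !piE. Qed.

Lemma quot_repr a : J (repr (quot_pi a) - a).
Proof. by apply/quot_piP; rewrite quot_piK. Qed.

Definition quot_scale (c : C) (x : star_quot) := quot_pi (c *: repr x).
Definition quot_mul (x y : star_quot) := quot_pi (repr x ** repr y).
Definition quot_star (x : star_quot) := quot_pi (star (repr x)).

Let idealZ (c : C) x : J x -> J (c *: x).
Proof. by move=> Jx; rewrite -[_ *: _]addr0; apply: idealD => //; exact: ideal0. Qed.

Let idealA x y : J x -> J y -> J (x + y).
Proof. by move=> Jx Jy; rewrite -[x]scale1r; apply: idealD. Qed.

Lemma quot_scaleE c a : quot_scale c (quot_pi a) = quot_pi (c *: a).
Proof. by apply/quot_piP; rewrite -scalerBr; apply/idealZ/quot_repr. Qed.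

Lemma quot_mulE a b : quot_mul (quot_pi a) (quot_pi b) = quot_pi (a ** b).
Proof.
apply/quot_piP; set a' := repr _; set b' := repr _.
have -> : a' ** b' - a ** b = (a' - a) ** b' + a ** (b' - b).
  by rewrite smulBl smulBr addrA subrK.
by apply: idealA; [apply/idealMr/quot_repr | apply/idealMl/quot_repr].
Qed.

Lemma quot_starE a : quot_star (quot_pi a) = quot_pi (star a).
Proof. by apply/quot_piP; rewrite -starB; apply/idealS/quot_repr. Qed.

Let qE := (quot_scaleE, quot_mulE, quot_starE, =^~ quot_piD).

Let qscaleA c d x : quot_scale c (quot_scale d x) = quot_scale (c * d) x.
Proof. by rewrite -(quot_piK x) !qE scalerA. Qed.
Let qscale1 : left_id 1 quot_scale.
Proof. by move=> x; rewrite -(quot_piK x) !qE scale1r. Qed.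
Let qscaleDr : right_distributive quot_scale +%R.
Proof.
by move=> c x y; rewrite -(quot_piK x) -(quot_piK y) !qE scalerDr.
Qed.
Let qscaleDl x : {morph quot_scale^~ x : c d / c + d}.
Proof. by move=> c d; rewrite -(quot_piK x) !qE scalerDl. Qed.

HB.instance Definition _ := GRing.Zmodule_isLmodule.Build C star_quot
  qscaleA qscale1 qscaleDr qscaleDl.

Let qZE c a : c *: quot_pi a = quot_pi (c *: a). Proof. exact: quot_scaleE. Qed.

Let qmulA : associative quot_mul.
Proof.
move=> x y z; rewrite -(quot_piK x) -(quot_piK y) -(quot_piK z) !qE.
by rewrite smulA.
Qed.
Let qmulDl : left_distributive quot_mul +%R.
Proof.
move=> x y z; rewrite -(quot_piK x) -(quot_piK y) -(quot_piK z) !qE.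
by rewrite smulDl.
Qed.
Let qmulDr : right_distributive quot_mul +%R.
Proof.
move=> x y z; rewrite -(quot_piK x) -(quot_piK y) -(quot_piK z) !qE.
by rewrite smulDr.
Qed.
Let qmulZl (c : C) x y : quot_mul (c *: x) y = c *: quot_mul x y.
Proof. by rewrite -(quot_piK x) -(quot_piK y) qZE !quot_mulE qZE smulZl. Qed.
Let qmulZr (c : C) x y : quot_mul x (c *: y) = c *: quot_mul x y.
Proof. by rewrite -(quot_piK x) -(quot_piK y) qZE !quot_mulE qZE smulZr. Qed.
Let qstarK : involutive quot_star.
Proof. by move=> x; rewrite -(quot_piK x) !qE starK. Qed.
Let qstarD : {morph quot_star : x y / x + y}.
Proof. by move=> x y; rewrite -(quot_piK x) -(quot_piK y) !qE starD. Qed.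
Let qstarZ (c : C) x : quot_star (c *: x) = c^* *: quot_star x.
Proof. by rewrite -(quot_piK x) qZE !quot_starE qZE starZ. Qed.
Let qstarM x y : quot_star (quot_mul x y) = quot_mul (quot_star y) (quot_star x).
Proof. by rewrite -(quot_piK x) -(quot_piK y) !qE starM. Qed.

HB.instance Definition _ := isStarAlgebra.Build C star_quot qmulA qmulDl qmulDr
  qmulZl qmulZr qstarK qstarD qstarZ qstarM.

Lemma quot_piZ c a : quot_pi (c *: a) = c *: quot_pi a.
Proof. by rewrite qZE. Qed.
Lemma quot_piM a b : quot_pi (a ** b) = quot_pi a ** quot_pi b.
Proof. by rewrite -quot_mulE. Qed.
Lemma quot_piS a : quot_pi (star a) = star (quot_pi a).
Proof. by rewrite -quot_starE. Qed.

End StarQuotient.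

Section Commutant.
Variables (C : numClosedFieldType) (B : starAlgType C) (A : starSubalg B).

Definition commutant_set : set B := [set b | forall a, A a -> a ** b = b ** a].

Lemma commutant0 : commutant_set 0.
Proof. by move=> a _; rewrite smul0l smul0r. Qed.
Lemma commutantD c x y : commutant_set x -> commutant_set y ->
  commutant_set (c *: x + y).
Proof.
by move=> cx cy a Aa; rewrite smulDl smulDr smulZl smulZr cx// cy.
Qed.
Lemma commutantM x y : commutant_set x -> commutant_set y ->
  commutant_set (x ** y).
Proof. by move=> cx cy a Aa; rewrite smulA cx// -smulA cy// smulA. Qed.
Lemma commutantS x : commutant_set x -> commutant_set (star x).
Proof.
by move=> cx a Aa; rewrite -[a]starK -!starM (cx _ (subalgS Aa)).
Qed.

Definition commutant : starSubalg B :=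
  StarSubalg commutant0 commutantD commutantM commutantS.

(* The annihilator of A is intersected with the commutant of A, where b ** a = 0
   amounts to a ** b = 0; it is an ideal there, though not in B in general. *)
Definition annihilator_set : set (subalg commutant) :=
  [set b | forall a, A a -> val b ** a = 0].

Lemma annihilator0 : annihilator_set 0.
Proof. by move=> a _; rewrite smul0l. Qed.
Lemma annihilatorD c x y : annihilator_set x -> annihilator_set y ->
  annihilator_set (c *: x + y).
Proof.
by move=> nx ny a Aa /=; rewrite smulDl smulZl nx// ny// scaler0 addr0.
Qed.
Lemma annihilatorMl b x : annihilator_set x -> annihilator_set (b ** x).
Proof. by move=> nx a Aa /=; rewrite -smulA nx// smul0r. Qed.
Lemma annihilatorMr b x : annihilator_set x -> annihilator_set (x ** b).
Proof.
move=> nx a Aa /=.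
by rewrite -smulA -(subalgP b _ Aa) smulA nx// smul0l.
Qed.
Lemma annihilatorS x : annihilator_set x -> annihilator_set (star x).
Proof.
move=> nx a Aa /=; have Asa := subalgS Aa.
by rewrite -[a]starK -starM (subalgP x _ Asa) nx// star0.
Qed.

Definition annihilator : starIdeal (subalg commutant) :=
  StarIdeal annihilator0 annihilatorD annihilatorMl annihilatorMr annihilatorS.

End Commutant.

HB.mixin Record isCStarAlgebra (R : realType) A
    of CompleteNormedModule R[i] A & StarAlgebra R[i] A := {
  normr_smul : forall x y : A, `|x ** y| <= `|x| * `|y|;
  normr_starM : forall x : A, `|star x ** x| = `|x| ^+ 2
}.

#[short(type="cstarAlgType")]
HB.structure Definition CStarAlgebra (R : realType) :=
  {A of CompleteNormedModule R[i] A & StarAlgebra R[i] A &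
        isCStarAlgebra R A}.

Lemma normr_star (R : realType) (A : cstarAlgType R) (x : A) :
  `|star x| = `|x|.
Proof.
have le_star y : `|y| <= `|star y| :> R[i].
  have [->|y0] := eqVneq y 0; first by rewrite star0.
  have y_gt0 : 0 < `|y| by rewrite normr_gt0.
  by rewrite -(ler_pM2r y_gt0) -expr2 -normr_starM normr_smul.
by apply/eqP; rewrite eq_le le_star -{2}[x]starK le_star.
Qed.

Definition nonprincipal (T : Type) (V : set_system T) :=
  forall t : T, ~ V [set t].

Section Ultrapower.
Context (R : realType) (A : cstarAlgType R).
Context (V : set_system nat) {UV : UltraFilter V}.
Implicit Types a b : nat -> A.

Definition linfty_set : set (nat -> A) :=
  [set a | exists M : R[i], forall n, `|a n| <= M].

Lemma linfty0 : linfty_set 0.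
Proof. by exists 0 => n; rewrite normr0. Qed.
Lemma linftyD (c : R[i]) a b : linfty_set a -> linfty_set b ->
  linfty_set (c *: a + b).
Proof.
move=> [M aM] [N bN]; exists (`|c| * M + N) => n.
by rewrite (le_trans (ler_normD _ _))// lerD// normrZ ler_wpM2l.
Qed.
Lemma linftyM a b : linfty_set a -> linfty_set b -> linfty_set (a ** b).
Proof.
move=> [M aM] [N bN]; exists (M * N) => n.
by rewrite (le_trans (normr_smul _ _))// ler_pM.
Qed.
Lemma linftyS a : linfty_set a -> linfty_set (star a).
Proof. by move=> [M aM]; exists M => n; rewrite normr_star. Qed.

Definition linfty : starSubalg (nat -> A) :=
  StarSubalg linfty0 linftyD linftyM linftyS.

(* The topology of R[i] lives on its alias R[i]^o. *)
Definition c_set : set (subalg linfty) :=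
  [set a | (fun n => `|val a n| : R[i]^o) @ V --> (0 : R[i]^o)].

Lemma c_setP (a : subalg linfty) :
  c_set a <-> forall e : R[i], 0 < e -> V [set n | `|val a n| < e].
Proof.
split=> [/cvgr0Pnorm_lt Va e e0|Va].
  by apply: filterS (Va _ e0) => n /=; rewrite normr_id.
apply/cvgr0Pnorm_lt => e e0.
by apply: filterS (Va _ e0) => n /=; rewrite normr_id.
Qed.

Let c_setM0 (a b : subalg linfty) (M : R[i]) : 0 <= M ->
  (forall n, `|val b n| <= M * `|val a n|) -> c_set a -> c_set b.
Proof.
move=> M0 ab /c_setP Va; apply/c_setP => e e0.
have M1 : 0 < M + 1 by rewrite ltr_wpDl.
apply: filterS (Va _ (divr_gt0 e0 M1)) => n /= an.
rewrite (le_lt_trans (ab n))//.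
rewrite (@le_lt_trans _ _ ((M + 1) * `|val a n|))//.
  by rewrite ler_wpM2r// lerDl.
by rewrite mulrC -ltr_pdivlMr.
Qed.

Let norm_bound (a : subalg linfty) : exists2 M : R[i], 0 <= M &
  forall n, `|val a n| <= M.
Proof.
by have [M aM] := subalgP a; exists M => //; exact: le_trans (aM 0).
Qed.

Lemma c_set0 : c_set 0.
Proof.
apply/c_setP => e e0; apply: filterS filterT => n _ /=.
by rewrite normr0.
Qed.
Lemma c_setD (c : R[i]) (a b : subalg linfty) : c_set a -> c_set b -> c_set (c *: a + b).
Proof.
move=> ca cb.
have /c_setP Va : c_set (c *: a).
  by apply: (@c_setM0 a _ `|c|) => // n; rewrite /= normrZ.
move/c_setP in cb; apply/c_setP => e e0.
have e2 : 0 < e / 2 by rewrite divr_gt0.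
apply: filterS (filterI (Va _ e2) (cb _ e2)) => n [/= an bn].
rewrite (le_lt_trans (ler_normD _ _))// [e]splitr.
exact: ltrD.
Qed.
Lemma c_setMl (a x : subalg linfty) : c_set x -> c_set (a ** x).
Proof.
have [M M0 aM] := norm_bound a; apply: (c_setM0 M0) => n /=.
by rewrite (le_trans (normr_smul _ _))// ler_wpM2r//; exact: aM.
Qed.
Lemma c_setMr (a x : subalg linfty) : c_set x -> c_set (x ** a).
Proof.
have [M M0 aM] := norm_bound a; apply: (c_setM0 M0) => n /=.
by rewrite (le_trans (normr_smul _ _))// mulrC ler_wpM2r//; exact: aM.
Qed.
Lemma c_setS (x : subalg linfty) : c_set x -> c_set (star x).
Proof. by apply: (c_setM0 ler01) => n /=; rewrite normr_star mul1r. Qed.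

Definition c_ideal : starIdeal (subalg linfty) :=
  StarIdeal c_set0 c_setD c_setMl c_setMr c_setS.

Definition ultrapower := star_quot c_ideal.

HB.instance Definition _ := StarAlgebra.on ultrapower.

Lemma linfty_cst (x : A) : linfty (fun=> x).
Proof. by exists `|x|. Qed.

Definition diag (x : A) : ultrapower := quot_pi c_ideal (to_subalg (linfty_cst x)).

Lemma diag_linear : linear diag.
Proof.
move=> c x y; rewrite /diag -quot_piZ -quot_piD; congr quot_pi.
exact: val_inj.
Qed.
Lemma diagM : {morph diag : x y / x ** y}.
Proof.
by move=> x y; rewrite /diag -quot_piM; congr quot_pi; exact: val_inj.
Qed.
Lemma diagS : {morph diag : x / star x}.
Proof.
by move=> x; rewrite /diag -quot_piS; congr quot_pi; exact: val_inj.
Qed.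

Lemma range_diag0 : range diag 0.
Proof.
exists 0 => //; have := diag_linear 1 0 0.
by rewrite !scale1r addr0 => /eqP; rewrite -subr_eq0 opprD addNKr oppr_eq0 => /eqP.
Qed.
Lemma range_diagD (c : R[i]) x y : range diag x -> range diag y ->
  range diag (c *: x + y).
Proof. by move=> [a _ <-] [b _ <-]; exists (c *: a + b); rewrite ?diag_linear. Qed.
Lemma range_diagM x y : range diag x -> range diag y -> range diag (x ** y).
Proof. by move=> [a _ <-] [b _ <-]; exists (a ** b); rewrite ?diagM. Qed.
Lemma range_diagS x : range diag x -> range diag (star x).
Proof. by move=> [a _ <-]; exists (star a); rewrite ?diagS. Qed.

Definition constants : starSubalg ultrapower :=
  StarSubalg range_diag0 range_diagD range_diagM range_diagS.

Definition F_algebra := star_quot (annihilator constants).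

HB.instance Definition _ := StarAlgebra.on F_algebra.

End Ultrapower.

Arguments ultrapower {R} A V {UV}.
Arguments constants {R} A V {UV}.
Arguments F_algebra {R} A V {UV}.

(* No cardinality lies strictly between those of nat and of its power set. *)
Definition continuum_hypothesis :=
  forall S : set (set nat), countable S \/ (S #= [set: set nat])%card.

(* The inner product is linear in its first argument. *)
HB.mixin Record isHilbert (R : realType) H
    of CompleteNormedModule R[i] H := {
  inner : {dot H for (@Num.conj R[i])};
  inner_norm : forall x : H, inner x x = `|x| ^+ 2
}.

#[short(type="hilbertType")]
HB.structure Definition Hilbert (R : realType) :=
  {H of CompleteNormedModule R[i] H & isHilbert R H}.

Arguments inner {R s}.

Definition separable_space (T : topologicalType) :=
  exists2 D : set T, countable D & dense D.

Definition infinite_dimensional (K : fieldType) (V : lmodType K) :=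
  forall (n : nat) (v : 'I_n -> V),
    exists x, forall c : 'I_n -> K, x <> \sum_i c i *: v i.

Section HilbertTheory.
Variables (R : realType) (H : hilbertType R).
Implicit Types (x y z h : H) (c : R[i]) (t : R).

Lemma innerDl x y z : inner (x + y) z = inner x z + inner y z.
Proof. exact: linearDl. Qed.
Lemma innerZl c x y : inner (c *: x) y = c * inner x y.
Proof. exact: linearZl_LR. Qed.
Lemma innerC x y : inner x y = (inner y x)^*%R.
Proof. by rewrite hermC expr0 mul1r. Qed.
Lemma innerDr x y z : inner x (y + z) = inner x y + inner x z.
Proof. by rewrite !(innerC x) innerDl rmorphD. Qed.
Lemma innerZr c x y : inner x (c *: y) = c^*%R * inner x y.
Proof. by rewrite !(innerC x) innerZl rmorphM. Qed.
Lemma inner0l y : inner 0 y = 0.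
Proof. by rewrite -(scale0r 0) innerZl mul0r. Qed.
Lemma innerNl x y : inner (- x) y = - inner x y.
Proof. by rewrite -scaleN1r innerZl mulN1r. Qed.
Lemma innerBl x y z : inner (x - y) z = inner x z - inner y z.
Proof. by rewrite innerDl innerNl. Qed.
Lemma innerNr x y : inner x (- y) = - inner x y.
Proof. by rewrite !(innerC x) innerNl rmorphN. Qed.
Lemma innerBr x y z : inner x (y - z) = inner x y - inner x z.
Proof. by rewrite innerDr innerNr. Qed.

Lemma inner_inj y z : (forall x, inner x y = inner x z) -> y = z.
Proof.
move=> yz; apply/eqP; rewrite -subr_eq0 -normr_eq0 -sqrf_eq0 -inner_norm.
by rewrite innerBr yz subrr.
Qed.

Let B x y : R := complex.Re (inner x y).
Let N x : R := B x x.

Let NE x : (N x)%:C%C = `|x| ^+ 2.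
Proof. by rewrite /N /B inner_norm RRe_real// ger0_real// exprn_ge0. Qed.

Let N_ge0 x : 0 <= N x.
Proof. by rewrite -ler0c NE exprn_ge0. Qed.

Let BDl x y z : B (x + y) z = B x z + B y z.
Proof. by rewrite /B innerDl raddfD. Qed.
Let BC x y : B x y = B y x.
Proof. by rewrite /B innerC; case: (inner y x). Qed.
Let BZl t x y : B (t%:C%C *: x) y = t * B x y.
Proof.
by rewrite /B innerZl; case: (inner x y) => a b /=; rewrite mul0r subr0.
Qed.
Let BNl x y : B (- x) y = - B x y.
Proof. by rewrite /B innerNl raddfN. Qed.
Let BDr x y z : B x (y + z) = B x y + B x z.
Proof. by rewrite BC BDl !(BC x). Qed.
Let BZr t x y : B x (t%:C%C *: y) = t * B x y.
Proof. by rewrite BC BZl BC. Qed.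
Let BNr x y : B x (- y) = - B x y.
Proof. by rewrite BC BNl BC. Qed.
Let BE := (BDl, BDr, BZl, BZr, BNl, BNr).

Let B_CS x y : B x y ^+ 2 <= N x * N y.
Proof.
have [Ny0|Ny0] := eqVneq (N y) 0.
  have -> : y = 0.
    by apply/eqP; rewrite -normr_eq0 -sqrf_eq0 -NE Ny0.
  by rewrite BC {1}/B inner0l expr0n mulr_ge0.
have Ny : 0 < N y by rewrite lt_neqAle eq_sym Ny0 N_ge0.
have := N_ge0 ((N y)%:C%C *: x - (B x y)%:C%C *: y).
rewrite {1}/N !BE (BC y x) -/(N x) -/(N y) => le0.
by rewrite -(ler_pM2l Ny); nra.
Qed.

Lemma inner_CS x y : `|inner x y| <= `|x| * `|y|.
Proof.
rewrite -(ler_pXn2r (n:=2)) ?nnegrE ?mulr_ge0// exprMn.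
have [-> | nz_y] := eqVneq y 0.
  by rewrite innerC inner0l rmorph0 !normr0 !expr0n mulr0.
pose a := inner x y / inner y y; pose u := x - a *: y.
have ny : 0 < `|y| ^+ 2 by rewrite exprn_gt0// normr_gt0.
have ou : inner u y = 0.
  by rewrite innerBl innerZl divfK ?subrr// inner_norm gt_eqF.
have ouC : inner y u = 0 by rewrite innerC ou rmorph0.
have xE : x = u + a *: y by rewrite subrK.
clearbody u.
have -> : `|x| ^+ 2 = `|u| ^+ 2 + `|a| ^+ 2 * `|y| ^+ 2.
  rewrite -!inner_norm {1 2}xE !(innerDl, innerDr, innerZl, innerZr) ou ouC.
  by rewrite !mulr0 !addr0 add0r mulrA -normCK.
rewrite mulrDl ler_wpDl ?mulr_ge0 ?exprn_ge0//.
rewrite normrM normfV inner_norm [`| `|y| ^+ 2|]gtr0_norm//.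
by rewrite exprMn mulrAC -mulrA -mulrA -expr2 -exprMn mulVf ?gt_eqF// expr1n mulr1.
Qed.

Section Riesz.
Variables (f : H -> R[i]) (K : R).
Hypothesis flin : forall c x y, f (c *: x + y) = c * f x + f y.
Hypothesis fbnd : forall x, complex.Re (f x) ^+ 2 <= K * N x.

Let g x : R := complex.Re (f x).
Let q x : R := N x - 2 * g x.

Let gD x y : g (x + y) = g x + g y.
Proof. by rewrite /g -[x]scale1r flin mul1r scale1r raddfD. Qed.
Let f0 : f 0 = 0.
Proof. by have := flin (-1) 0 0; rewrite scaler0 addr0 mulN1r addNr. Qed.
Let gZ t x : g (t%:C%C *: x) = t * g x.
Proof.
rewrite /g -[_ *: _]addr0 flin f0 addr0.
by case: (f x) => a b /=; rewrite mul0r subr0.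
Qed.

Let q_lb x : - `|K| <= q x.
Proof.
have K0 := normr_ge0 K; have := N_ge0 x; rewrite /q => N0.
have gb : g x ^+ 2 <= `|K| * N x.
  by rewrite (le_trans (fbnd x))// ler_wpM2r// ler_norm.
suff : 2 * g x <= `|K| + N x by lra.
have [g0|g0] := ltP (g x) 0; first by lra.
have h1 : 2 * g x \is Num.nneg by rewrite nnegrE; lra.
have h2 : `|K| + N x \is Num.nneg by rewrite nnegrE; lra.
rewrite -(ler_sqr h1 h2); have := sqr_ge0 (`|K| - N x); nra.
Qed.

Let m := inf (range q).

Let q_has_lb : has_lbound (range q).
Proof. by exists (- `|K|) => _ [x _ <-]; exact: q_lb. Qed.

Let m_le x : m <= q x.
Proof. by apply: ge_inf => //; exists x. Qed.

Let m_adh (e : R) : 0 < e -> exists x, q x < m + e.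
Proof.
move=> e0; have hi : has_inf (range q) by split=> //; exists (q 0), 0.
by have [_ [x _ <-] qx] := inf_adherent e0 hi; exists x.
Qed.

Let para x y (e : R) : q x < m + e -> q y < m + e -> N (x - y) <= 4 * e.
Proof.
move=> qx qy; have := m_le (2^-1%:C%C *: (x + y)).
rewrite /q gZ gD {1}/N !BE (BC y x) => mm.
rewrite /N !BE (BC y x); move: qx qy; rewrite /q /N; lra.
Qed.

Let near_min x h (e : R) : 0 < e -> q x < m + e ->
  (B x h - g h) ^+ 2 <= e * (N h + 1).
Proof.
move=> e0 qx; set a := B x h - g h; have Nh := N_ge0 h.
have N1 : 0 < N h + 1 by lra.
pose t := - a / (N h + 1).
have := m_le (x + t%:C%C *: h); rewrite /q gD gZ {1}/N !BE (BC h x).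
rewrite -/(N x) -/(N h) => mm.
have key : - e <= 2 * t * a + t ^+ 2 * N h.
  by move: qx; rewrite /q /a; nra.
have tE : t * (N h + 1) = - a by rewrite /t divfK ?gt_eqF.
have a2 : a ^+ 2 = t ^+ 2 * (N h + 1) ^+ 2 by rewrite -exprMn tE sqrrN.
have ta : t * a = - (t ^+ 2 * (N h + 1)).
  by rewrite expr2 -mulrA tE mulrN opprK.
have le1 : t ^+ 2 * (N h + 1) <= e.
  by have t2 : 0 <= t ^+ 2 := sqr_ge0 t; nra.
by rewrite a2 expr2 mulrA ler_wpM2r// ltW.
Qed.

Lemma riesz_re : exists z, forall h, complex.Re (f h) = B h z.
Proof.
have /choice[u uP] : forall k : nat, exists x, q x < m + k.+1%:R^-1.
  by move=> k; apply: m_adh; rewrite invr_gt0.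
have inv_le j k : (j <= k)%N -> k.+1%:R^-1 <= j.+1%:R^-1 :> R.
  by move=> jk; rewrite lef_pV2 ?posrE// ler_nat ltnS.
have small (d : R) : 0 < d -> exists k : nat, k.+1%:R^-1 < d.
  move=> d0; exists (Num.bound d^-1).
  rewrite invf_plt ?posrE// (lt_trans (archi_boundP _))// ?ltr_nat//.
  by rewrite ltW// invr_gt0.
have /cauchy_cvg/cvg_ex[z uz] : cauchy (u @ \oo).
  apply: cauchy_exP => e e0.
  have [r r0 eE] : exists2 r : R, 0 < r & e = r%:C%C.
    exists (complex.Re e); first by rewrite -ltcR RRe_real// gtr0_real.
    by rewrite RRe_real// gtr0_real.
  have [k kr] := small (r ^+ 2 / 4) (divr_gt0 (exprn_gt0 2 r0) (ltr0n _ 4)).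
  exists (u k); exists k => // j /= kj.
  rewrite -ball_normE /= eE -(ltr_pXn2r (n:=2)) ?nnegrE//; last first.
    by rewrite ler0c ltW.
  rewrite -NE -rmorphXn/= ltcR.
  have qj : q (u j) < m + k.+1%:R^-1.
    by rewrite (lt_le_trans (uP j))// lerD2l inv_le.
  by move: kr (para (uP k) qj); set w := k.+1%:R^-1; lra.
exists z => h; rewrite -/(g h) BC.
pose a := B z h - g h; suff /eqP : a = 0 by rewrite subr_eq0 => /eqP.
have C0 : 0 < 4 * N h + 2 by have := N_ge0 h; lra.
have az d : 0 < d -> d <= 1 -> a ^+ 2 <= d * (4 * N h + 2).
  move=> d0 d1; have [k kd] := small d d0.
  have dC : 0 < d%:C%C by rewrite ltcR.
  have : \forall n \near \oo, `|z - u n| < d%:C%C by move/cvgrPdist_lt: uz; apply.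
  move=> [n0 _ un0]; pose n := maxn n0 k.
  have zn : N (z - u n) < d ^+ 2.
    rewrite -ltcR NE rmorphXn/= ltr_pXn2r// ?nnegrE ?ler0c// ?ltW//.
    exact: un0 n (leq_maxl _ _).
  have n0' : 0 < n.+1%:R^-1 :> R by rewrite invr_gt0.
  have nd : n.+1%:R^-1 < d by rewrite (le_lt_trans (inv_le _ _ (leq_maxr n0 k))).
  have h1 := near_min h n0' (uP n).
  have h2 := B_CS (z - u n) h.
  have Nh := N_ge0 h.
  have aE : a = (B (u n) h - g h) + B (z - u n) h by rewrite /a !BE; ring.
  set p := B (u n) h - g h in h1 aE; set s := B (z - u n) h in h2 aE.
  have : a ^+ 2 <= 2 * p ^+ 2 + 2 * s ^+ 2.
    by rewrite aE; have := sqr_ge0 (p - s); nra.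
  have : p ^+ 2 <= d * (N h + 1) by rewrite (le_trans h1)// ler_wpM2r ?(ltW nd)//; lra.
  have : s ^+ 2 <= d * N h.
    rewrite (le_trans h2)// ler_wpM2r// (le_trans (ltW zn))//.
    by rewrite expr2 ler_piMr// ltW.
  lra.
apply/eqP; apply/negP => /negP a0.
have a2 : 0 < a ^+ 2 by rewrite exprn_even_gt0.
pose d := Num.min 1 (a ^+ 2 / (2 * (4 * N h + 2))).
have d0 : 0 < d by rewrite lt_min ltr01 divr_gt0// mulr_gt0.
have d1 : d <= 1 by rewrite /d ge_min lexx.
have := az d d0 d1.
have : d * (4 * N h + 2) <= a ^+ 2 / (2 * (4 * N h + 2)) * (4 * N h + 2).
  by apply: ler_wpM2r; rewrite ?(ltW C0)// /d ge_min lexx orbT.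
have -> : a ^+ 2 / (2 * (4 * N h + 2)) * (4 * N h + 2) = a ^+ 2 / 2.
  by field; rewrite gt_eqF.
lra.
Qed.

End Riesz.

Lemma riesz (f : H -> R[i]) (K : R) :
    (forall c x y, f (c *: x + y) = c * f x + f y) ->
    (forall x, `|f x| <= K%:C%C * `|x|) ->
  exists z, forall h, f h = inner h z.
Proof.
move=> flin fbnd; have f0 : f 0 = 0.
  by have := flin (-1) 0 0; rewrite scaler0 addr0 mulN1r addNr.
have fZ c x : f (c *: x) = c * f x.
  by have := flin c x 0; rewrite f0 !addr0.
have [|z zP] := @riesz_re f (K ^+ 2) flin.
  move=> x; rewrite -lecR [leRHS]rmorphM/= NE [X in X * _]rmorphXn/= -exprMn.
  apply: (@le_trans _ _ (`|f x| ^+ 2)).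
    by rewrite -add_Re2_Im2 lecR lerDl sqr_ge0.
  by rewrite lerXn2r ?nnegrE//; exact: le_trans (fbnd x).
exists z => h; apply/eqP; rewrite eq_complex zP eqxx /=.
have := zP ('i%C *: h); rewrite fZ /B innerZl.
by case: (f h) (inner h z) => [a b] [c d] /=; rewrite !mul0r !mul1r !sub0r => /oppr_inj->.
Qed.

End HilbertTheory.

Section BoundedOperators.
Variables (R : realType) (H : hilbertType R).

Definition bounded_linear : {pred H -> H} := fun f =>
  `[< linear f /\ exists M : R[i], forall x, `|f x| <= M * `|x| >].

Let bounded_linear_submod : submod_closed bounded_linear.
Proof.
split.
  apply/asboolP; split; first by move=> c x y /=; rewrite scaler0 addr0.
  by exists 0 => x; rewrite normr0 mul0r.
move=> c f g /asboolP[fl [M fM]] /asboolP[gl [N gN]]; apply/asboolP; split.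
  move=> d x y; rewrite !fctE /= fl gl !scalerDr !scalerA mulrC.
  by rewrite -!addrA; congr (_ + _); rewrite addrCA.
exists (`|c| * M + N) => x.
rewrite (le_trans (ler_normD _ _))// mulrDl lerD//.
by rewrite normrZ -mulrA ler_wpM2l.
Qed.

HB.instance Definition _ :=
  GRing.isSubmodClosed.Build R[i] (H -> H) bounded_linear bounded_linear_submod.

Record bounded_op := BoundedOp { bop_fun :> H -> H; bopP : bop_fun \in bounded_linear }.

HB.instance Definition _ := [isSub for bop_fun].
HB.instance Definition _ := [Choice of bounded_op by <:].
HB.instance Definition _ := [SubChoice_isSubLmodule of bounded_op by <:].

Implicit Types S T : bounded_op.

Lemma bop_ext S T : (forall x, S x = T x) -> S = T.
Proof. by move=> ST; apply/val_inj/funext. Qed.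

Lemma bop_linear T : linear T.
Proof. by have /asboolP[] := bopP T. Qed.

Lemma bop0 T : T 0 = 0.
Proof.
by have := bop_linear T (-1) 0 0; rewrite scaler0 addr0 scaleN1r addNr.
Qed.

Lemma bopD T x y : T (x + y) = T x + T y.
Proof. by have := bop_linear T 1 x y; rewrite !scale1r. Qed.

Lemma bopZ T (c : R[i]) x : T (c *: x) = c *: T x.
Proof. by have := bop_linear T c x 0; rewrite bop0 !addr0. Qed.

Definition op_bounds T : set R :=
  [set r | 0 <= r /\ forall x, `|T x| <= r%:C%C * `|x|].

Definition opnorm T : R[i] := (inf (op_bounds T))%:C%C.

Lemma op_bounds_neq0 T : op_bounds T !=set0.
Proof.
have /asboolP[_ [M TM]] := bopP T.
have [[x x0]|H0] := pselect (exists x : H, x != 0).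
  have M0 : 0 <= M.
    have : 0 <= M * `|x| by exact: le_trans (TM x).
    by rewrite pmulr_lge0// normr_gt0.
  exists (complex.Re M); split; first by rewrite -ler0c RRe_real// ger0_real.
  by move=> y; rewrite RRe_real// ger0_real.
exists 0; split=> // x; rewrite mul0r normr_le0; apply: contra_notT H0 => Tx.
by exists (T x).
Qed.

Let op_bounds_lb T : has_lbound (op_bounds T).
Proof. by exists 0 => r []. Qed.

Lemma opnorm_ge0 T : 0 <= opnorm T.
Proof.
by rewrite ler0c; apply: lb_le_inf; [exact: op_bounds_neq0|move=> r []].
Qed.

Lemma opnormP T x : `|T x| <= opnorm T * `|x|.
Proof.
have [->|x0] := eqVneq x 0.
  by rewrite bop0 normr0 mulr0.
have nx : 0 < `|x| by rewrite normr_gt0.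
rewrite -ler_pdivrMr//.
have rE : (complex.Re (`|T x| / `|x|))%:C%C = `|T x| / `|x|.
  by rewrite RRe_real// ger0_real// divr_ge0.
rewrite -rE lecR; apply: lb_le_inf; first exact: op_bounds_neq0.
by move=> r [r0 Tr]; rewrite -lecR rE ler_pdivrMr.
Qed.

Lemma opnorm_min T (M : R[i]) : 0 <= M ->
  (forall x, `|T x| <= M * `|x|) -> opnorm T <= M.
Proof.
move=> M0 TM; have ME : (complex.Re M)%:C%C = M by rewrite RRe_real// ger0_real.
rewrite -ME lecR; apply: ge_inf => //.
by split=> [|x]; rewrite -?ler0c ME.
Qed.

Let opnormD S T : opnorm (S + T) <= opnorm S + opnorm T.
Proof.
apply: opnorm_min => [|x]; first by rewrite addr_ge0// opnorm_ge0.
by rewrite (le_trans (ler_normD _ _))// mulrDl lerD// opnormP.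
Qed.

Let opnormZ_le (c : R[i]) T : opnorm (c *: T) <= `|c| * opnorm T.
Proof.
apply: opnorm_min => [|x]; first by rewrite mulr_ge0// opnorm_ge0.
by rewrite normrZ -mulrA ler_wpM2l// opnormP.
Qed.

Let opnormZ (c : R[i]) T : opnorm (c *: T) = `|c| * opnorm T.
Proof.
apply/eqP; rewrite eq_le opnormZ_le /=.
have [->|c0] := eqVneq c 0; first by rewrite normr0 mul0r opnorm_ge0.
have nc : 0 < `|c| by rewrite normr_gt0.
rewrite -ler_pdivlMl// -normfV.
by rewrite (le_trans _ (opnormZ_le _ _))// scalerK.
Qed.

Let opnorm0_eq0 T : opnorm T = 0 -> T = 0.
Proof.
move=> T0; apply: bop_ext => x; apply/eqP; rewrite -normr_le0.
by rewrite (le_trans (opnormP _ _))// T0 mul0r.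
Qed.

HB.instance Definition _ :=
  Lmodule_isNormed.Build R[i] bounded_op opnormD opnormZ opnorm0_eq0.

Let bop_complete (F : set_system bounded_op) : ProperFilter F -> cauchy F -> cvg F.
Proof.
move=> FF /cauchyP Fc.
have Fx x : cvg ((fun S : bounded_op => S x) @ F).
  apply: cauchy_cvg; apply: cauchy_exP => e e0.
  have x1 : 0 < `|x| + 1 by rewrite ltr_wpDl.
  have [S FS] := Fc _ (divr_gt0 e0 x1).
  exists (S x); suff : F [set T : bounded_op | ball (S x) e (T x)] by [].
  apply: filterS FS => T; rewrite -!ball_normE /= => ST.
  rewrite (le_lt_trans (opnormP (S - T) x))//.
  rewrite (@le_lt_trans _ _ (opnorm (S - T) * (`|x| + 1)))//.
    by rewrite ler_wpM2l ?opnorm_ge0// lerDl.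
  by rewrite -ltr_pdivlMr.
have Lex x : exists y : H, (fun S : bounded_op => S x) @ F --> y.
  by exists (lim ((fun S : bounded_op => S x) @ F)); exact: Fx.
have [L LP] := choice Lex.
have Llin : linear L.
  move=> c x y; apply: (norm_cvg_unique (LP (c *: x + y))).
  have -> : (fun S : bounded_op => S (c *: x + y)) = (fun S : bounded_op => c *: S x + S y).
    by apply/funext => S; exact: bop_linear.
  by apply: cvgD; [apply: cvgZr; exact: LP|exact: LP].
have near_lim S (e : R[i]) x : 0 < e -> F (ball S e) ->
    `|S x - L x| <= e * `|x|.
  move=> e0 FS; apply/ler_addgt0Pr => d d0.
  have /cvgrPdist_lt /(_ d d0) Fd := LP x.
  have [T [ST LT]] := filter_ex (filterI FS Fd).
  rewrite -(subrKA (T x)) (le_trans (ler_normD _ _))// lerD//; last first.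
    by rewrite distrC ltW.
  rewrite (le_trans (opnormP (S - T) x))// ler_wpM2r// ltW//.
have Lbnd : exists M : R[i], forall x, `|L x| <= M * `|x|.
  have [S FS] := Fc 1 ltr01; exists (1 + opnorm S) => x.
  rewrite -[L x](subrK (S x)) (le_trans (ler_normD _ _))// mulrDl lerD//.
    by rewrite distrC near_lim.
  exact: opnormP.
pose T : bounded_op := BoundedOp (asboolT (conj Llin Lbnd)).
apply/cvg_ex; exists T; apply/cvgrPdist_le => e e0.
have e2 : 0 < e / 2 by rewrite divr_gt0.
have [S FS] := Fc _ e2; apply: filterS (FS) => U SU.
rewrite -(subrKA S) (le_trans (ler_normD _ _))// [e]splitr lerD//.
  apply: opnorm_min => [|x]; first exact: ltW.
  by rewrite distrC; exact: near_lim.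
by move: SU; rewrite -ball_normE /= => /ltW.
Qed.

HB.instance Definition _ := Uniform_isComplete.Build bounded_op bop_complete.

Let comp_bounded S T : (S : H -> H) \o T \in bounded_linear.
Proof.
apply/asboolP; split; first by move=> c x y /=; rewrite !bop_linear.
exists (opnorm S * opnorm T) => x; rewrite (le_trans (opnormP _ _))//.
by rewrite -mulrA ler_wpM2l ?opnorm_ge0// opnormP.
Qed.

Definition bop_comp S T : bounded_op := BoundedOp (comp_bounded S T).

Let adjoint_ex T : exists T' : bounded_op, forall x y, inner (T x) y = inner x (T' y).
Proof.
have NE x : `|x| ^+ 2 = inner x x :> R[i] by rewrite inner_norm.
have CS := @inner_CS R H.
have /choice[A AP] : forall y, exists z, forall x, inner (T x) y = inner x z.
  move=> y; apply: (@riesz _ _ _ (complex.Re (opnorm T * `|y|))).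
    by move=> c x x'; rewrite bop_linear innerDl innerZl.
  move=> x; rewrite RRe_real ?ger0_real ?mulr_ge0 ?opnorm_ge0//.
  rewrite (le_trans (CS _ _))// mulrAC ler_wpM2r//.
  exact: opnormP.
have Alin : linear A.
  move=> c y y'; apply: inner_inj => x.
  by rewrite -AP !innerDr !innerZr !AP.
have Abnd : exists M : R[i], forall x, `|A x| <= M * `|x|.
  exists (opnorm T) => y; have [->|Ay] := eqVneq (A y) 0.
    by rewrite normr0 mulr_ge0// opnorm_ge0.
  have nAy : 0 < `|A y| by rewrite normr_gt0.
  rewrite -(ler_pM2r nAy) -expr2 NE -AP -[leLHS]ger0_norm; last first.
    by rewrite AP inner_norm exprn_ge0.
  by rewrite (le_trans (CS _ _))// mulrAC ler_wpM2r// opnormP.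
by exists (BoundedOp (asboolT (conj Alin Abnd))).
Qed.

Definition adjoint T : bounded_op := projT1 (cid (adjoint_ex T)).

Lemma adjointP T x y : inner (T x) y = inner x (adjoint T y).
Proof. exact: (projT2 (cid (adjoint_ex T)) x y). Qed.

Let adjoint_uniq S T :
  (forall x y, inner (T x) y = inner x (S y)) -> adjoint T = S.
Proof.
move=> TS; apply: bop_ext => y; apply: inner_inj => x.
by rewrite -adjointP TS.
Qed.

Let compA : associative bop_comp.
Proof. by move=> S T U; apply: bop_ext. Qed.
Let compDl : left_distributive bop_comp +%R.
Proof. by move=> S T U; apply: bop_ext. Qed.
Let compDr : right_distributive bop_comp +%R.
Proof. by move=> S T U; apply: bop_ext => x; exact: bopD. Qed.
Let compZl (c : R[i]) S T : bop_comp (c *: S) T = c *: bop_comp S T.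
Proof. exact: bop_ext. Qed.
Let compZr (c : R[i]) S T : bop_comp S (c *: T) = c *: bop_comp S T.
Proof. by apply: bop_ext => x; exact: bopZ. Qed.
Let adjointK : involutive adjoint.
Proof.
by move=> T; apply: adjoint_uniq => x y; rewrite innerC -adjointP -innerC.
Qed.
Let adjointD : {morph adjoint : S T / S + T}.
Proof.
move=> S T; apply: adjoint_uniq => x y /=.
by rewrite innerDl innerDr !adjointP.
Qed.
Let adjointZ (c : R[i]) T : adjoint (c *: T) = c^*%R *: adjoint T.
Proof.
apply: adjoint_uniq => x y /=.
by rewrite innerZl innerZr conjCK adjointP.
Qed.
Let adjointM S T : adjoint (bop_comp S T) = bop_comp (adjoint T) (adjoint S).
Proof. by apply: adjoint_uniq => x y /=; rewrite !adjointP. Qed.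

HB.instance Definition _ := isStarAlgebra.Build R[i] bounded_op compA compDl compDr
  compZl compZr adjointK adjointD adjointZ adjointM.

Let normr_comp S T : `|S ** T| <= `|S| * `|T|.
Proof.
apply: opnorm_min => [|x]; first by rewrite mulr_ge0.
rewrite (le_trans (opnormP S _))// -mulrA ler_wpM2l ?opnorm_ge0//.
exact: opnormP.
Qed.

Let normr_adjM T : `|star T ** T| = `|T| ^+ 2.
Proof.
have le1 S : `|S| ^+ 2 <= `|star S ** S|.
  rewrite -[leRHS]sqrtCK lerXn2r ?nnegrE ?sqrtC_ge0//.
  apply: opnorm_min => [|x]; first by rewrite sqrtC_ge0.
  suff : `|S x| ^+ 2 <= (sqrtC `|star S ** S| * `|x|) ^+ 2.
    by rewrite ler_pXn2r ?nnegrE ?mulr_ge0 ?sqrtC_ge0.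
  rewrite exprMn sqrtCK -inner_norm adjointP -[leLHS]ger0_norm; last first.
    by rewrite -adjointP inner_norm exprn_ge0.
  rewrite (le_trans (inner_CS _ _))// expr2 mulrA mulrC ler_wpM2r//.
  exact: opnormP (star S ** S) x.
have le2 S : `|S| <= `|star S|.
  have [->|S0] := eqVneq S 0; first by rewrite normr0.
  have nS : 0 < `|S| by rewrite normr_gt0.
  by rewrite -(ler_pM2r nS) -expr2 (le_trans (le1 S))// normr_comp.
apply/eqP; rewrite eq_le le1 andbT (le_trans (normr_comp _ _))// expr2.
by rewrite ler_wpM2r// (le_trans (le2 _))// starK.
Qed.

HB.instance Definition _ := isCStarAlgebra.Build R bounded_op normr_comp normr_adjM.

End BoundedOperators.

(* Main.v *)
Require Import Defs.
From mathcomp Require Import all_boot all_order all_algebra complex.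
From mathcomp Require Import boolp classical_sets functions cardinality filter.
From mathcomp Require Import wochoice reals topology normedtype.
From mathcomp Require Import ring lra.
Set Implicit Arguments.
Unset Strict Implicit.
Unset Printing Implicit Defensive.
Import Order.TTheory GRing.Theory Num.Theory.
Import numFieldNormedType.Exports.
Local Open Scope classical_set_scope.

(* Write P_t for the projection onto the first t vectors of an orthonormal basis.

   One ultrafilter has a nontrivial commutant: index it by finite sequences
   s_0 < ... < s_{k-1} and let a_s be the average of the P_{s_i}. In
   [T, P_t] = (1 - P_t) T P_t - P_t T (1 - P_t), if s_{i+1} is large enough given
   s_i and T, then (1 - P_{s_i}) T P_{s_i} is nearly
   (P_{s_{i+1}} - P_{s_i}) T P_{s_i}. These have orthogonal ranges, so their
   average has norm at most |T| / sqrt k; the other term is an adjoint of this one.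
   An ultrafilter containing all sets of long, fast growing sequences makes (a_s)
   central, and a_s is far from the scalars.

   For a selective ultrafilter, which CH provides, the commutant is trivial: if
   (b_n) is central then, up to a scalar, b_n e_j -> 0 for each j. Were |b_n| >= r,
   there would be unit vectors z_n of finite support with |b_n z_n| >= r / 2, and
   selectivity gives n_0 < n_1 < ... in V-many places such that the z_{n_{i+1}} may be
   cut down to mutually orthogonal v_i while b_{n_{i+1}} e_i is small. The bounded
   operator S with S e_i = v_i then does not asymptotically commute with b. *)

(** * A selective ultrafilter *)

Definition unbounded (X : set nat) := forall N, exists2 n, X n & (N <= n)%N.

Definition almost_sub (X Y : set nat) :=
  exists N, forall n, (N <= n)%N -> X n -> Y n.

(* Pulls back a well-order of set nat along a bijection with its least uncountable
   initial segment, if there is one; CH provides the bijection. *)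
Lemma omega1_order : continuum_hypothesis ->
  exists lt : set nat -> set nat -> Prop,
    [/\ well_founded lt, forall x y, [\/ lt x y, x = y | lt y x]
      & forall y, countable [set x | lt x y]].
Proof.
move=> CH; have [R Rwo] := well_ordering_principle (set nat).
(* [R] is a reflexive order, so its strict part is [~~ R y x]. *)
have Rwf : well_founded (fun x y => ~~ R y x).
  move=> x; apply: contrapT => nx.
  have [|z [[zP zmin] _]] := Rwo [pred x | `[< ~ Acc (fun x y => ~~ R y x) x >]].
    by exists x; apply/asboolP.
  move/asboolP: zP; apply; constructor=> y Ryz; apply: contrapT => ny.
  by move/negP: Ryz; apply; apply: zmin; apply/asboolP.
have Rtot x y : R x y \/ R y x.
  have : chain R predT by apply: wo_chainW => A _; exact: Rwo.
  by move=> /(_ x y isT isT) /orP.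
have Ranti x y : R x y -> R y x -> x = y.
  move=> Rxy Ryx; have : {in predT &, antisymmetric R}.
    by apply: wo_chain_antisymmetric => A _; exact: Rwo.
  by move=> /(_ x y isT isT); rewrite Rxy Ryx => /(_ isT).
have tri x y : [\/ ~~ R y x, x = y | ~~ R x y].
  have [Ryx|] := boolP (R y x); last by constructor 1.
  have [Rxy|] := boolP (R x y); last by constructor 3.
  by constructor 2; exact: Ranti.
pose I y := [set x | ~~ R y x].
have [small|big] := pselect (forall y, countable (I y)).
  by exists (fun x y => ~~ R y x).
have [|a [[aP amin] _]] := Rwo [pred y | `[< ~ countable (I y) >]].
  by move/existsNP: big => [y ny]; exists y; apply/asboolP.
move/asboolP: aP => aP.
have Ismall x : I a x -> countable (I x).
  move=> /negP Iax; apply: contrapT => nx; apply: Iax; apply: amin.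
  exact/asboolP.
(* [I a] is uncountable, so CH gives it the cardinality of [set nat]; below each of its points only
   countably many lie, by minimality of [a]. *)
have [//|Sbij] := CH (I a); rewrite card_eq_sym in Sbij.
have /card_set_bijP[h [hfun /in2TT hinj _]] := Sbij.
have hI x : I a (h x) by exact: hfun.
exists (fun x y => ~~ R (h y) (h x)); split=> [|x y|y].
- move=> x; have := Rwf (h x); move: {-2}(h x) (erefl (h x)) => z zE Az.
  elim: Az x zE => {}z _ IH x zE; constructor=> y; rewrite -zE => yz.
  exact: IH yz y erefl.
- by case: (tri (h x) (h y)) => [|/hinj|];
    [constructor 1|constructor 2|constructor 3].
- have /countable_injP[f finj] := Ismall _ (hI y).
  apply/countable_injP; exists (f \o h) => u v.
  by rewrite !inE => uy vy /finj; rewrite !inE => /(_ uy vy)/hinj.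
Qed.

(** Each step picks the next term beyond the present one, so the constraint on a term may depend on
    the value of its predecessor. *)
Lemma increasing_selection (D : nat -> set nat) : (forall m, unbounded (D m)) ->
  exists y : nat -> nat, [/\ forall k, (y k < y k.+1)%N, D 0 (y 0)
    & forall k, D (y k) (y k.+1)].
Proof.
move=> Dinf.
have /choice[f fP] : forall m, exists n, D m n /\ (m < n)%N.
  by move=> m; have [n] := Dinf m m.+1; exists n.
have [z Dz _] := Dinf 0 0; pose y := fix y k := if k is k'.+1 then f (y k') else z.
by exists y; split=> // k; have [] := fP (y k).
Qed.

Lemma increasing_le (y : nat -> nat) : (forall k, (y k < y k.+1)%N) ->
  (forall k, (k <= y k)%N) /\ {homo y : i j / (i <= j)%N}.
Proof.
move=> yS; split; first by elim=> // k IH; exact: leq_ltn_trans (yS k).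
apply: homo_leq => [//|n m p|n]; [exact: leq_trans|exact: ltnW].
Qed.

Lemma increasing_lt (y : nat -> nat) : (forall k, (y k < y k.+1)%N) ->
  {mono y : i j / (i < j)%N}.
Proof. by move=> yS; apply: leqW_mono; apply: leq_mono; apply: homo_ltn yS; exact: ltn_trans. Qed.

(** Among finitely many members of the chain one is almost contained in all the others, so finite
    intersections are unbounded; a diagonal choice of points from them gives [Y]. *)
Lemma pseudo_intersection (C : nat -> set nat) :
    (forall i, unbounded (C i)) ->
    (forall i j, almost_sub (C i) (C j) \/ almost_sub (C j) (C i)) ->
  exists2 Y, unbounded Y & forall i, almost_sub Y (C i).
Proof.
move=> Cinf Cchain.
have Csub k : exists2 j, True & forall i, (i <= k)%N -> almost_sub (C j) (C i).
  elim: k => [|k [j _ jP]].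
    by exists 0 => // i; rewrite leqn0 => /eqP->; exists 0.
  case: (Cchain j k.+1) => [[N NP]|[N NP]].
    exists j => // i; rewrite leq_eqVlt => /predU1P[->|/jP//].
    by exists N.
  exists k.+1 => // i; rewrite leq_eqVlt => /predU1P[->|/jP[M MP]]; first by exists 0.
  exists (maxn N M) => n; rewrite geq_max => /andP[Nn Mn] Cn.
  by apply: MP => //; exact: NP.
pose D k := [set n | forall i, (i <= k)%N -> C i n].
have [|y [yS _ Dy]] := @increasing_selection D.
  move=> k N; have [j _ jP] := Csub k.
  (* A common threshold for finitely many almost inclusions. *)
  have [M MP] : exists M, forall i n, (i <= k)%N -> (M <= n)%N -> C j n -> C i n.
    suff : forall l, (l <= k)%N -> exists M, forall i n,
        (i <= l)%N -> (M <= n)%N -> C j n -> C i n by apply.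
    elim=> [|l IH] lk.
      have [M MP] := jP 0 lk; exists M => i n; rewrite leqn0 => /eqP->; exact: MP.
    have [M MP] := IH (ltnW lk); have [M' MP'] := jP l.+1 lk.
    exists (maxn M M') => i n; rewrite geq_max leq_eqVlt => /predU1P[->|il] /andP[Mn Mn'].
      exact: MP'.
    exact: MP.
  have [n Cn] := Cinf j (maxn N M); rewrite geq_max => /andP[Nn Mn].
  by exists n => // i ik; exact: MP.
have [yk ymon] := increasing_le yS.
exists (range y) => [N|i]; first by exists (y N) => //; exists N.
(* A point [y k] past [y i.+1] has [k > i]; it was chosen in [D (y k.-1)], and [i <= y k.-1]. *)
exists (y i.+1) => _ /[swap] -[k _ <-].
rewrite leqNgt (increasing_lt yS) -leqNgt.
case: k => // k ik; apply: Dy; exact: leq_trans (yk k).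
Qed.

(** Transfinite recursion: the countably many earlier sets form a chain under almost inclusion, so
    they have a pseudo-intersection, which is then refined to satisfy [P t]. *)
Lemma tower (T : Type) (lt : T -> T -> Prop) (P : T -> set nat -> Prop) :
    well_founded lt -> (forall x y, [\/ lt x y, x = y | lt y x]) ->
    (forall y, countable [set x | lt x y]) ->
    (forall t Y, unbounded Y -> exists X, [/\ X `<=` Y, unbounded X & P t X]) ->
  exists X : T -> set nat,
    [/\ forall t, unbounded (X t), forall s t, lt s t -> almost_sub (X t) (X s)
      & forall t, P t (X t)].
Proof.
move=> wf tri cnt refine.
pose good t (rec : forall s, lt s t -> set nat) X :=
  [/\ unbounded X, forall s st, almost_sub X (rec s st) & P t X].
(* The default [setT] never occurs: [Xgood] shows by induction that each stage has a good set. *)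
pose step t rec := if pselect (exists X, @good t rec X) is left h
  then projT1 (cid h) else setT.
pose X := Fix wf (fun=> set nat) step.
have XE t : X t = step t (fun s _ => X s).
  rewrite /X Fix_eq// => s f g fg; congr step.
  by apply/functional_extensionality_dep => u; apply/funext => h.
have Xgood t : good t (fun s _ => X s) (X t).
  elim/(well_founded_ind wf): t => t IH.
  rewrite XE /step; case: pselect => [h|]; first exact: (projT2 (cid h)).
  case.
  have [[s0 s0t]|no] := pselect (exists s, lt s t); last first.
    have [|Z [_ Zinf ZP]] := refine t setT; first by move=> N; exists N.
    by exists Z; split=> // s st; case: no; exists s.
  (* Enumerates the predecessors of [t], with [s0] at the indices that code none. *)
  have [f [fsub fsurj]] : exists f : nat -> T, (forall i, lt (f i) t) /\
      forall s, lt s t -> exists i, f i = s.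
    have /countable_injP[g ginj] := cnt t.
    pose f i := if pselect (exists2 s, lt s t & g s = i) is left h
      then projT1 (cid2 h) else s0.
    exists f; split=> [i|s st]; first by rewrite /f; case: pselect => // h; case: cid2.
    exists (g s); rewrite /f; case: pselect => [h|[]]; last by exists s.
    by case: cid2 => u /= ut /ginj; apply; rewrite inE.
  have [||Y Yinf Ysub] := @pseudo_intersection (X \o f).
  - by move=> i; have [] := IH _ (fsub i).
  - move=> i j /=; case: (tri (f i) (f j)) => [ij|->|ji].
    + by right; have [_ /(_ _ ij)] := IH _ (fsub j).
    + by left; exists 0.
    + by left; have [_ /(_ _ ji)] := IH _ (fsub i).
  have [Z [ZY Zinf ZP]] := refine t Y Yinf.
  exists Z; split=> // s st; have [i <-] := fsurj s st.
  by have [N NP] := Ysub i; exists N => n Nn /ZY; exact: NP.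
by exists X; split=> [t|s t st|t]; have [? Xs ?] := Xgood t => //; exact: Xs.
Qed.

(** The first point [y 0] is unconstrained, so each use of a diagonal set discards it. *)
Definition diagonal (A : nat -> set nat) (X : set nat) :=
  exists y : nat -> nat, [/\ forall k, (y k < y k.+1)%N, X = range y
    & forall k, A (y k) (y k.+1)].

(* For constant A this decides A, hence makes a filter of such X an ultrafilter. *)
Lemma diagonal_refinement (A : nat -> set nat) (Y : set nat) : unbounded Y ->
  exists X, [/\ X `<=` Y, unbounded X
    & (exists m, forall n, X n -> exists2 j, (j <= m)%N & ~ A j n)
      \/ diagonal A X].
Proof.
move=> Yinf; pose D m := [set n | Y n /\ forall j, (j <= m)%N -> A j n].
have [Dinf|/existsNP[m mP]] := pselect (forall m, unbounded (D m)).
  have [y [yS D0 Dy]] := increasing_selection Dinf.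
  exists (range y); split.
  - by move=> _ [[|k] _ <-]; [case: D0|case: (Dy k)].
  - move=> N; exists (y N); first by exists N.
    by have [+ _] := increasing_le yS; exact.
  - by right; exists y; split=> // k; have [_] := Dy k; exact.
have /existsNP[N NP] := mP.
(* Beyond [N] no point of [Y] lies in [D m], so this set is a tail of [Y]. *)
exists ((Y `\` D m) `&` [set n | (N <= n)%N]); split.
- by move=> n [[]].
- move=> M; have [n Yn] := Yinf (maxn N M); rewrite geq_max => /andP[Nn Mn].
  by exists n => //; split=> //; split=> // Dn; apply: NP; exists n.
- left; exists m => n [[Yn nD] _]; apply: contrapT => nex.
  by apply: nD; split=> // j jm; apply: contrapT => nA; apply: nex; exists j.
Qed.

(** The diagonal form of the notion of selective, or Ramsey, ultrafilter. *)
Definition selective (V : set_system nat) :=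
  forall A : nat -> set nat, (forall m, V (A m)) ->
    exists2 X, V X & diagonal A X.

Lemma finite_bigcap_filter (V : set_system nat) {FV : Filter V}
    (A : nat -> set nat) : (forall m, V (A m)) ->
  forall m, V [set n | forall j, (j <= m)%N -> A j n].
Proof.
move=> VA; elim=> [|m IH].
  by apply: filterS (VA 0) => n An j; rewrite leqn0 => /eqP->.
apply: filterS (filterI IH (VA m.+1)) => n [An An'] j.
by rewrite leq_eqVlt => /predU1P[->|/An].
Qed.

(** The filter is generated by a tower whose stages treat all sequences of sets; constant sequences
    make it maximal, arbitrary ones make it selective. *)
Lemma selective_ultrafilter : continuum_hypothesis ->
  exists V : set_system nat, [/\ UltraFilter V, nonprincipal V & selective V].
Proof.
move=> CH; have [lt [wf tri cnt]] := omega1_order CH.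
(* One set of naturals codes a whole sequence of sets, so [set nat] can index the tower. *)
pose dec (S : set nat) (m : nat) : set nat := [set n | S (pickle (m, n))].
have decK (A : nat -> set nat) : exists S, dec S = A.
  exists [set k | exists m n, k = pickle (m, n) /\ A m n].
  apply/funext => m; apply/seteqP; split=> n /=; last by move=> An; exists m, n.
  by move=> [m' [n' [mn An]]]; have [-> ->] := pcan_inj pickleK mn.
have [X [Xinf Xsub XP]] := tower wf tri cnt (fun S => @diagonal_refinement (dec S)).
pose V : set_system nat := [set Z | exists t, almost_sub (X t) Z].
have VX t : V (X t) by exists t, 0.
have VS Y Z : Y `<=` Z -> V Y -> V Z.
  by move=> YZ [t [N NP]]; exists t, N => n Nn Xn; apply: YZ; exact: NP.
have VFF : ProperFilter V.
  apply: Build_ProperFilter_ex.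
    move=> Z [t [N NP]]; have [n Xn Nn] := Xinf t N.
    by exists n; exact: NP.
  split=> [|Y Z|//]; first by exists set0, 0.
  move=> [t [N NP]] [s [M MP]].
  have [u [[K KP] [L LP]]] : exists u, almost_sub (X u) (X t) /\ almost_sub (X u) (X s).
    case: (tri t s) => [ts|->|st].
    + by exists s; split; [exact: Xsub|exists 0].
    + by exists s; split; exists 0.
    + by exists t; split; [exists 0|exact: Xsub].
  exists u, (maxn (maxn N M) (maxn K L)) => n.
  rewrite !geq_max => /andP[/andP[Nn Mn] /andP[Kn Ln]] Xn.
  by split; [apply/NP/KP|apply/MP/LP].
have sel A : (exists t m, X t `<=` [set n | exists2 j, (j <= m)%N & ~ A j n])
    \/ exists2 Z, V Z & diagonal A Z.
  have [S <-] := decK A; case: (XP S) => [[m mP]|dX]; first by left; exists S, m.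
  by right; exists (X S).
exists V; split.
- split=> // G GF VG; apply/seteqP; split=> // Z GZ.
  (* Either some [X t] misses [Z], which puts the complement of [Z] in [G], or a diagonal set in [V]
     lies in [Z] except perhaps for [y 0]. *)
  case: (sel (fun=> Z)) => [[t [m mP]]|[Y VY dY]].
    have GnZ : G (~` Z).
      by apply: VG; apply: VS (VX t) => n /mP[].
    by have [n []] := filter_ex (filterI GZ GnZ).
  have [y [yS YE yZ]] := dY; have [t [N NP]] := VY.
  exists t, (maxn N (y 0).+1) => n; rewrite geq_max => /andP[Nn yn] Xn.
  have := NP _ Nn Xn; rewrite YE => -[[|k] _ kn]; last by rewrite -kn.
  by move: yn; rewrite kn ltnn.
- move=> k [t [N NP]]; have [n Xn] := Xinf t (maxn N k.+1).
  by rewrite geq_max => /andP[/NP/(_ Xn) ->]; rewrite ltnn.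
- move=> A VA; case: (sel A) => [[t [m mP]]|//].
  (* The first alternative is impossible: [X t] meets every finite intersection of the [A j]. *)
  have [n [Xn An]] := filter_ex (filterI (VX t) (finite_bigcap_filter VA m)).
  by have [j /An] := mP n Xn.
Qed.

Local Open Scope ring_scope.

(** * Real-valued norms and the geometry of inner products *)

Definition cnorm (R : realType) (c : R[i]) : R := complex.Re `|c|.

Lemma cnormE (R : realType) (c : R[i]) : `|c| = (cnorm c)%:C%C.
Proof. by rewrite /cnorm RRe_real// ger0_real. Qed.

Lemma cnorm_ge0 (R : realType) (c : R[i]) : 0 <= cnorm c.
Proof. by rewrite -ler0c -cnormE. Qed.

Lemma cnorm_eq0 (R : realType) (c : R[i]) : cnorm c = 0 -> c = 0.
Proof. by move=> c0; apply: normr0_eq0; rewrite cnormE c0. Qed.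

Section RealNorm.
Variables (R : realType) (V : normedModType R[i]).
Implicit Types x y : V.

(* Norms live in the partially ordered field R[i]; nrm is their real value. *)
Definition nrm x : R := complex.Re `|x|.

Lemma nrmE x : `|x| = (nrm x)%:C%C.
Proof. by rewrite /nrm RRe_real// ger0_real. Qed.

Lemma nrm_ge0 x : 0 <= nrm x.
Proof. by rewrite -ler0c -nrmE. Qed.

Lemma nrm0 : nrm 0 = 0.
Proof. by rewrite /nrm normr0. Qed.

Lemma nrm_eq0 x : nrm x = 0 -> x = 0.
Proof. by move=> x0; apply: normr0_eq0; rewrite nrmE x0. Qed.

Lemma nrm_gt0 x : x != 0 -> 0 < nrm x.
Proof. by rewrite lt_def nrm_ge0 andbT; apply: contra_neq; exact: nrm_eq0. Qed.

Lemma nrmD x y : nrm (x + y) <= nrm x + nrm y.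
Proof. by rewrite -lecR rmorphD /= -!nrmE ler_normD. Qed.

Lemma nrmN x : nrm (- x) = nrm x.
Proof. by rewrite /nrm normrN. Qed.

Lemma nrmB x y : nrm (x - y) <= nrm x + nrm y.
Proof. by rewrite -(nrmN y) nrmD. Qed.

Lemma nrm_sum (I : Type) (s : seq I) (F : I -> V) :
  nrm (\sum_(i <- s) F i) <= \sum_(i <- s) nrm (F i).
Proof.
elim/big_ind2: _ => [|x a y b xa yb|//]; first by rewrite nrm0.
by rewrite (le_trans (nrmD _ _))// lerD.
Qed.

Lemma nrmZ (c : R[i]) x : nrm (c *: x) = cnorm c * nrm x.
Proof.
by apply/complexI; rewrite rmorphM /= -!nrmE normrZ cnormE.
Qed.

Lemma nrmZr (t : R) x : 0 <= t -> nrm (t%:C%C *: x) = t * nrm x.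
Proof. by move=> t0; rewrite nrmZ /cnorm ger0_norm ?ler0c. Qed.

End RealNorm.

Lemma pos_complexE (R : realType) (e : R[i]) : 0 < e ->
  exists2 r : R, 0 < r & e = r%:C%C.
Proof.
move=> e0; have eE : (complex.Re e)%:C%C = e by rewrite RRe_real// gtr0_real.
by exists (complex.Re e); rewrite // -ltcR eE.
Qed.

Section HilbertGeometry.
Variables (R : realType) (H : hilbertType R).
Implicit Types (x y z : H).

Lemma inner_nrm x : inner x x = (nrm x ^+ 2)%:C%C.
Proof. by rewrite inner_norm nrmE rmorphXn. Qed.

Lemma inner0r x : inner x 0 = 0.
Proof. by rewrite innerC inner0l rmorph0. Qed.

Lemma inner_suml (I : Type) (s : seq I) (F : I -> H) y :
  inner (\sum_(i <- s) F i) y = \sum_(i <- s) inner (F i) y.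
Proof.
by apply: (big_morph (fun z => inner z y)) => [u v|]; [exact: innerDl|exact: inner0l].
Qed.

Lemma inner_eq0C x y : inner x y = 0 -> inner y x = 0.
Proof. by move=> xy; rewrite innerC xy rmorph0. Qed.

Lemma nrm_CS x y : cnorm (inner x y) <= nrm x * nrm y.
Proof. by rewrite -lecR -cnormE rmorphM /= -!nrmE inner_CS. Qed.

Lemma pythagoras x y : inner x y = 0 -> nrm (x + y) ^+ 2 = nrm x ^+ 2 + nrm y ^+ 2.
Proof.
move=> xy; apply/complexI; rewrite rmorphD /= -!inner_nrm.
by rewrite innerDl !innerDr xy (inner_eq0C xy) addr0 add0r.
Qed.

End HilbertGeometry.

(** * Orthonormal bases and operators *)

Section GramSchmidt.
Variables (R : realType) (H : hilbertType R).
Implicit Types (x y v d : H) (s : seq H).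

Fixpoint orthonormal s := if s is v :: s' then
  [/\ inner v v = 1, forall u, u \in s' -> inner u v = 0 & orthonormal s'] else True.

Definition proj s x := \sum_(u <- s) inner x u *: u.

Lemma proj_inner s x : orthonormal s ->
  forall u, u \in s -> inner (proj s x) u = inner x u.
Proof.
elim: s => // v s IH [vv sv os] u.
rewrite /proj big_cons innerDl innerZl -/(proj s x) inE => /predU1P[->|us].
  rewrite vv mulr1 inner_suml big_seq big1 ?addr0// => w ws.
  by rewrite innerZl sv// mulr0.
by rewrite (inner_eq0C (sv _ us)) mulr0 add0r IH.
Qed.

(** Normalises the part orthogonal to [s] of a vector [y]: of [d] itself if it is outside the span
    of [s], and otherwise of any vector outside, which infinite dimension provides. *)
Lemma orthonormal_extend s d : infinite_dimensional H -> orthonormal s ->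
  exists v, orthonormal (v :: s) /\ proj (v :: s) d = d.
Proof.
move=> infH os.
have [y [y0 yd]] : exists y, y - proj s y <> 0 /\ (d - proj s d = 0 \/ y = d).
  have [d0|d0] := pselect (d - proj s d = 0); last by exists d; split; auto.
  have [x xP] := infH (size s) (fun i => nth 0 s i).
  exists x; split; last by left.
  move/eqP; rewrite subr_eq0 => /eqP xE.
  apply: (xP (fun i => inner x (nth 0 s i))).
  by rewrite {1}xE /proj (big_nth 0) big_mkord.
pose r := y - proj s y; pose v := (nrm r)^-1%:C%C *: r.
have r0 : 0 < nrm r by apply: nrm_gt0; apply/eqP.
have rs u : u \in s -> inner r u = 0.
  by move=> us; rewrite /r innerBl proj_inner// subrr.
have vs u : u \in s -> inner v u = 0 by move=> us; rewrite innerZl rs// mulr0.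
have vv : inner v v = 1.
  by rewrite inner_nrm nrmZr ?invr_ge0 ?nrm_ge0// mulVf ?gt_eqF// expr1n.
exists v; split; first by split=> // u us; apply: inner_eq0C; exact: vs.
have pv x : inner (proj s x) v = 0.
  rewrite inner_suml big_seq big1// => u us.
  by rewrite innerZl (inner_eq0C (vs _ us)) mulr0.
rewrite /proj big_cons -/(proj s d).
case: yd => [/eqP|yd].
  rewrite subr_eq0 => /eqP dE.
  by rewrite {1}dE pv scale0r add0r.
have -> : inner d v = inner r v by rewrite /r innerBl pv subr0 yd.
rewrite {1}/v innerZr inner_nrm conj_Creal; last first.
  by rewrite ger0_real// ler0c invr_ge0 ltW.
rewrite /v scalerA -!rmorphM /= expr2 mulKf ?gt_eqF// mulfV ?gt_eqF//.
by rewrite scale1r /r yd subrK.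
Qed.

End GramSchmidt.

Definition orthonormal_basis (R : realType) (H : hilbertType R) (e : nat -> H) :=
  (forall i j, inner (e i) (e j) = (i == j)%:R) /\
  forall (x : H) (d : R), 0 < d -> exists N, forall n, (N <= n)%N ->
    nrm (x - \sum_(j < n) inner x (e j) *: e j) <= d.

Lemma dense_enumeration (R : realType) (H : hilbertType R) : separable_space H ->
  exists d : nat -> H, forall x (r : R), 0 < r -> exists n, nrm (x - d n) < r.
Proof.
move=> [D /countable_injP[g ginj] Dd].
pose d k : H := if pselect (exists2 x, D x & g x = k) is left h
  then projT1 (cid2 h) else 0.
have dg x : D x -> d (g x) = x.
  move=> Dx; rewrite /d; case: pselect => [h|[]]; last by exists x.
  by case: cid2 => u /= Du /ginj; apply; rewrite inE.
exists d => x r r0; have rC : 0 < r%:C%C by rewrite ltcR.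
have [|y [xy Dy]] := Dd _ _ (open_interior (ball x r%:C%C)).
  by exists x; exact: nbhsx_ballx.
exists (g y); rewrite dg// -ltcR -nrmE.
by move/interior_subset: xy; rewrite -ball_normE.
Qed.

(** The process runs through a dense sequence [d]. Once [d m] is in the span, [x] and [x - d m] have
    the same residual, so its norm is at most the distance from [x] to [d m]. *)
Lemma Gram_Schmidt (R : realType) (H : hilbertType R) :
  separable_space H -> infinite_dimensional H ->
  exists e : nat -> H, orthonormal_basis e.
Proof.
move=> /dense_enumeration[d dP] infH.
have /choice[g gP] : forall sx : seq H * H, exists v, orthonormal sx.1 ->
    orthonormal (v :: sx.1) /\ proj (v :: sx.1) sx.2 = sx.2.
  move=> [s x] /=; have [os|nos] := pselect (orthonormal s); last by exists 0.
  by have [v vP] := orthonormal_extend x infH os; exists v.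
pose L := fix L n := if n is n'.+1 then g (L n', d n') :: L n' else [::].
pose e n := g (L n, d n).
have oL n : orthonormal (L n) by elim: n => // n IH; have [] := gP (L n, d n) IH.
have eL i n : (i < n)%N -> e i \in L n.
  elim: n => // n IH; rewrite ltnS leq_eqVlt inE => /predU1P[->|/IH ->].
    by rewrite eqxx.
  by rewrite orbT.
have projE n x : proj (L n) x = \sum_(j < n) inner x (e j) *: e j.
  elim: n => [|n IH]; first by rewrite /proj big_nil big_ord0.
  by rewrite /proj big_cons -/(proj _ _) IH big_ord_recr addrC.
have ee i j : (i < j)%N -> inner (e i) (e j) = 0.
  by move=> ij; have [_ + _] := oL j.+1; apply; exact: eL.
have oe i j : inner (e i) (e j) = (i == j)%:R.
  case: (ltngtP i j) => [/ee//|/ee/inner_eq0C//|<-].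
  by have [] := oL i.+1.
have resid n x : nrm (x - proj (L n) x) <= nrm x.
  rewrite -(@ler_pXn2r _ 2) ?nnegrE ?nrm_ge0//.
  have : inner (x - proj (L n) x) (proj (L n) x) = 0.
    apply: inner_eq0C; rewrite inner_suml big_seq big1// => u us.
    have ru : inner (x - proj (L n) x) u = 0 by rewrite innerBl proj_inner ?subrr.
    by rewrite innerZl (inner_eq0C ru) mulr0.
  by move/pythagoras; rewrite subrK => ->; rewrite lerDl exprn_ge0 ?nrm_ge0.
have projd n m : (n < m)%N -> proj (L m) (d n) = d n.
  elim: m => // m IH; rewrite ltnS leq_eqVlt => /predU1P[<-|nm].
    by have [] := gP (L n, d n) (oL n).
  rewrite /proj big_cons -/(proj _ _) IH// -[RHS]add0r; congr (_ + _).
  rewrite -(IH nm) inner_suml big_seq big1 ?scale0r// => u us.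
  by rewrite innerZl; have [_ -> //] := oL m.+1; rewrite mulr0.
exists e; split=> // x r r0; have [m xm] := dP x r r0; exists m.+1 => n mn.
rewrite -projE; apply: le_trans (ltW xm); apply: le_trans (resid n _).
rewrite le_eqVlt; apply/orP; left; apply/eqP; congr nrm.
have -> : proj (L n) (x - d m) = proj (L n) x - d m.
  rewrite -{2}(projd _ _ mn) /proj -sumrB.
  by apply: eq_bigr => u _; rewrite innerBl scalerBl.
by rewrite opprB addrA subrK.
Qed.


Section Operators.
Variables (R : realType) (H : hilbertType R).
Implicit Types (x y u v : H) (S T : bounded_op H).

Lemma bopDE S T x : (S + T) x = S x + T x. Proof. by []. Qed.
Lemma bopNE T x : (- T) x = - T x. Proof. by []. Qed.
Lemma bopZE (c : R[i]) T x : (c *: T) x = c *: T x. Proof. by []. Qed.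
Lemma bopME S T x : (S ** T) x = S (T x). Proof. by []. Qed.
Lemma bopBE S T x : (S - T) x = S x - T x. Proof. by []. Qed.

Definition bopE := (bopBE, bopDE, bopNE, bopZE, bopME).

Lemma bopN T x : T (- x) = - T x.
Proof. by rewrite -scaleN1r bopZ scaleN1r. Qed.

Lemma bopB T x y : T (x - y) = T x - T y.
Proof. by rewrite bopD bopN. Qed.

Lemma bop_sumE (I : Type) (s : seq I) (F : I -> bounded_op H) x :
  (\sum_(i <- s) F i) x = \sum_(i <- s) F i x.
Proof. exact: (big_morph (fun T : bounded_op H => T x)). Qed.

Lemma nrm_op T x : nrm (T x) <= nrm T * nrm x.
Proof. by rewrite -lecR rmorphM /= -!nrmE; exact: opnormP. Qed.

Lemma nrm_op_le T (M : R) : 0 <= M -> (forall x, nrm (T x) <= M * nrm x) ->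
  nrm T <= M.
Proof.
move=> M0 TM; rewrite -lecR -nrmE; apply: opnorm_min => [|x].
  by rewrite ler0c.
by rewrite !nrmE -rmorphM lecR.
Qed.

Lemma nrm_adjoint T : nrm (star T) = nrm T.
Proof. by rewrite /nrm normr_star. Qed.

Lemma star_sum (I : Type) (s : seq I) (F : I -> bounded_op H) :
  star (\sum_(i <- s) F i) = \sum_(i <- s) star (F i).
Proof. by apply: (big_morph _ (@starD _ _)); exact: star0. Qed.

Lemma smul_suml (I : Type) (s : seq I) (F : I -> bounded_op H) T :
  (\sum_(i <- s) F i) ** T = \sum_(i <- s) F i ** T.
Proof.
by apply: (big_morph (fun S => S ** T)) => [S S'|]; [exact: smulDl|exact: smul0l].
Qed.

Lemma smul_sumr (I : Type) (s : seq I) (F : I -> bounded_op H) T :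
  T ** (\sum_(i <- s) F i) = \sum_(i <- s) T ** F i.
Proof.
by apply: (big_morph (fun S => T ** S)) => [S S'|]; [exact: smulDr|exact: smul0r].
Qed.

Lemma rank1_subproof u v : (fun x => inner x v *: u) \in @bounded_linear R H.
Proof.
apply/asboolP; split=> [c x y|]; first by rewrite innerDl innerZl scalerDl scalerA.
by exists (`|v| * `|u|) => x; rewrite normrZ mulrAC ler_wpM2r// mulrC inner_CS.
Qed.

Definition rank1 u v : bounded_op H := BoundedOp (rank1_subproof u v).

Lemma rank1E u v x : rank1 u v x = inner x v *: u. Proof. by []. Qed.

Lemma id_subproof : (fun x => x) \in @bounded_linear R H.
Proof. by apply/asboolP; split=> [c x y //|]; exists 1 => x; rewrite mul1r. Qed.

Definition id_op : bounded_op H := BoundedOp id_subproof.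

Lemma id_opE x : id_op x = x. Proof. by []. Qed.

Lemma star_eq S T : (forall x y, inner (T x) y = inner x (S y)) -> star T = S.
Proof.
move=> TS; apply: bop_ext => y; apply: inner_inj => x.
by rewrite -adjointP TS.
Qed.

End Operators.

Section BasisProjections.
Variables (R : realType) (H : hilbertType R) (e : nat -> H).
Hypothesis he : orthonormal_basis e.
Implicit Types (x y : H) (T : bounded_op H).

Lemma basis_inner i j : inner (e i) (e j) = (i == j)%:R.
Proof. by have [+ _] := he; apply. Qed.

Lemma nrm_basis i : nrm (e i) = 1.
Proof.
have : nrm (e i) ^+ 2 = 1.
  by apply/complexI; rewrite -inner_nrm basis_inner eqxx.
by move/eqP; rewrite sqrf_eq1 => /orP[/eqP//|/eqP e1];
  have := nrm_ge0 (e i); rewrite e1; lra.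
Qed.

Definition P n : bounded_op H := \sum_(j < n) rank1 (e j) (e j).

Lemma PE n x : P n x = \sum_(j < n) inner x (e j) *: e j.
Proof. by rewrite bop_sumE. Qed.

Lemma P_rec n x : P n.+1 x = P n x + inner x (e n) *: e n.
Proof. by rewrite !PE big_ord_recr. Qed.

Lemma P_basis n i : P n (e i) = if (i < n)%N then e i else 0.
Proof.
elim: n => [|n IH]; first by rewrite PE big_ord0.
rewrite P_rec IH basis_inner ltnS (leq_eqVlt i n).
by case: (ltngtP i n) => [_|_|->] /=; rewrite ?scale0r ?addr0// scale1r add0r.
Qed.

Lemma inner_P n x i : inner (P n x) (e i) = if (i < n)%N then inner x (e i) else 0.
Proof.
elim: n => [|n IH]; first by rewrite PE big_ord0 inner0l.
rewrite P_rec innerDl innerZl IH basis_inner ltnS (leq_eqVlt i n).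
by rewrite (eq_sym n); case: (ltngtP i n) => [_|_|->] /=; rewrite ?mulr0 ?addr0// mulr1 add0r.
Qed.

Lemma P_self n x y : inner (P n x) y = inner x (P n y).
Proof.
elim: n => [|n IH]; first by rewrite !PE !big_ord0 inner0l inner0r.
by rewrite !P_rec innerDl innerDr IH innerZl innerZr -innerC mulrC.
Qed.

Lemma star_P n : star (P n) = P n.
Proof. by apply: star_eq => x y; exact: P_self. Qed.

Lemma PP m n x : P m (P n x) = P (minn m n) x.
Proof.
elim: m => [|m IH]; first by rewrite min0n !PE !big_ord0.
rewrite P_rec IH inner_P; case: ltnP => mn.
  by rewrite (minn_idPl mn) P_rec.
by rewrite (minn_idPr (leqW mn)) scale0r addr0.
Qed.

Lemma P_orth m n x y : (n <= m)%N -> P m y = 0 -> inner (P n x) y = 0.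
Proof.
move=> nm Py; have -> : P n x = P m (P n x) by rewrite PP (minn_idPr nm).
by rewrite P_self Py inner0r.
Qed.

Lemma nrm_P_decomp n x : nrm x ^+ 2 = nrm (P n x) ^+ 2 + nrm (x - P n x) ^+ 2.
Proof.
rewrite -pythagoras; first by rewrite addrC subrK.
by apply: (P_orth _ (leqnn n)); rewrite bopB PP minnn subrr.
Qed.

Lemma nrm_P n x : nrm (P n x) <= nrm x.
Proof.
rewrite -(@ler_pXn2r _ 2) ?nnegrE ?nrm_ge0// (nrm_P_decomp n x).
by rewrite lerDl exprn_ge0 ?nrm_ge0.
Qed.

Lemma nrm_subP n x : nrm (x - P n x) <= nrm x.
Proof.
rewrite -(@ler_pXn2r _ 2) ?nnegrE ?nrm_ge0// (nrm_P_decomp n x).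
by rewrite lerDr exprn_ge0 ?nrm_ge0.
Qed.

Lemma P_cvg x (d : R) : 0 < d -> exists N, forall n, (N <= n)%N ->
  nrm (x - P n x) <= d.
Proof.
move=> d0; have [_ /(_ x d d0)[N NP]] := he; exists N => n /NP.
by rewrite -PE.
Qed.

(** [T P_n] has finite rank, so its tails vanish uniformly in [x]; the induction adds one column at
    a time. *)
Lemma column_tail T n (d : R) : 0 < d -> exists N, forall m, (N <= m)%N ->
  forall x, nrm (T (P n x) - P m (T (P n x))) <= d * nrm x.
Proof.
elim: n d => [|n IH] d d0.
  exists 0%N => m _ x; rewrite PE big_ord0 !bop0 subr0 nrm0.
  by rewrite mulr_ge0 ?nrm_ge0// ltW.
have d2 : 0 < d / 2 by lra.
have [N NP] := IH _ d2; have [M MP] := P_cvg (T (e n)) d2.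
exists (maxn N M) => m; rewrite geq_max => /andP[Nm Mm] x.
rewrite P_rec !bopD !bopZ opprD addrACA -scalerBr.
apply: le_trans (nrmD _ _) _; rewrite nrmZ.
have xn : cnorm (inner x (e n)) <= nrm x.
  by rewrite (le_trans (nrm_CS _ _))// nrm_basis mulr1.
have := ler_pM (cnorm_ge0 _) (nrm_ge0 _) xn (MP m Mm).
have := NP m Nm x; lra.
Qed.

End BasisProjections.


(** * The ultrafilter with nontrivial commutant *)

(** Starting the path at 0 makes every entry positive, on which [average_head] relies. *)
Definition fast_growing (f : nat -> nat) : seq nat -> bool :=
  path (fun a b => (a < b) && (f a <= b))%N 0.

Definition seq_of (n : nat) : seq nat := odflt [::] (unpickle n).

Lemma seq_ofK s : seq_of (pickle s) = s.
Proof. by rewrite /seq_of pickleK. Qed.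

(** The prescribed sets form a filter base: intersections are handled by pointwise maxima, and
    iterating a fast growing function shows that none is empty. *)
Lemma flat_ultrafilter : exists U : set_system nat,
  [/\ UltraFilter U, nonprincipal U & forall f k,
    U [set n | (k <= size (seq_of n))%N /\ fast_growing f (seq_of n)]].
Proof.
pose B (p : (nat -> nat) * nat) :=
  [set n | (p.2 <= size (seq_of n))%N /\ fast_growing p.1 (seq_of n)].
have BF : ProperFilter (filter_from setT B).
  apply: filter_from_proper.
    apply: filter_from_filter; first by exists (id, 0%N).
    move=> [f k] [g l] _ _; exists (fun a => maxn (f a) (g a), maxn k l) => //.
    move=> n [/=]; rewrite geq_max => /andP[kn ln] fg.
    by split; split=> //; apply: sub_path fg => a b /andP[->];
      rewrite geq_max => /andP[].
  move=> [f k] _; pose g a := maxn a.+1 (f a).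
  exists (pickle (traject g (g 0%N) k)); rewrite /B /mkset seq_ofK.
  split; first by rewrite size_traject.
  apply: (@sub_path _ (frel g)); last exact: fpath_traject.
  by move=> a b /= /eqP <-; rewrite leq_maxl leq_maxr.
have [U [UU BU]] := ultraFilterLemma BF.
have UB f k : U (B (f, k)) by apply: BU; exists (f, k).
exists U; split=> // n Un.
(* If the singleton of [n] were in [U], [seq_of n] would be longer than itself. *)
have [m [-> []]] := filter_ex (filterI Un (UB id (size (seq_of n)).+1)).
by rewrite ltnn.
Qed.

Section FlatCommutant.
Variables (R : realType) (H : hilbertType R) (e : nat -> H).
Hypothesis he : orthonormal_basis e.
Implicit Types (x y : H) (T : bounded_op H) (s : seq nat).

Local Notation P := (P e).

(* The vector w is the sum of the orthogonal (P_{s_{i+1}} - P_{s_i}) T P_{s_i} x. *)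
Lemma staircase T f (d : R) x :
    (forall t m, (f t <= m)%N -> nrm (T (P t x) - P m (T (P t x))) <= d * nrm x) ->
  forall s t, path (fun a b => (a < b) && (f a <= b))%N t s ->
  exists w, [/\ P t w = 0, nrm w ^+ 2 <= (size s).+1%:R * (nrm T * nrm x) ^+ 2 &
    nrm (\sum_(u <- t :: s) (T (P u x) - P u (T (P u x))) - w)
      <= (size s).+1%:R * (d * nrm x)].
Proof.
move=> tail; have dx : 0 <= d * nrm x by apply: le_trans (tail 0%N _ (leqnn _)); exact: nrm_ge0.
have TPx t : nrm (T (P t x) - P t (T (P t x))) <= nrm T * nrm x.
  rewrite (le_trans (nrm_subP he _ _))// (le_trans (nrm_op _ _))//.
  by rewrite ler_wpM2l ?nrm_ge0// nrm_P.
have sqTPx y : nrm y <= nrm T * nrm x -> nrm y ^+ 2 <= (nrm T * nrm x) ^+ 2.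
  by move=> yT; rewrite lerXn2r ?nnegrE ?mulr_ge0 ?nrm_ge0.
elim=> [|u s IH] t.
  (* The last entry keeps its whole tail, as no later entry cuts it off. *)
  move=> _; exists (T (P t x) - P t (T (P t x))); split.
  - by rewrite bopB (PP he) minnn subrr.
  - by rewrite mul1r sqTPx.
  - by rewrite big_seq1 subrr nrm0 mul1r.
move=> /= /andP[/andP[tu ftu] us]; have [w [Pw wT wd]] := IH u us.
set y := T (P t x); exists (P u y - P t y + w); split.
- rewrite bopD bopB !(PP he) minnn (minn_idPl (ltnW tu)) subrr add0r.
  by have := congr1 (P t) Pw; rewrite (PP he) (minn_idPl (ltnW tu)) bop0.
(* The new term lies in the range of [P u], to which [w] is orthogonal. *)
- rewrite pythagoras; last first.
    rewrite innerBl (P_orth he _ (leqnn u) Pw) (P_orth he _ (ltnW tu) Pw).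
    by rewrite subrr.
  rewrite -natr1 addrC mulrDl mul1r lerD// sqTPx//.
  have -> : P u y - P t y = P u (y - P t y).
    by rewrite bopB (PP he) (minn_idPr (ltnW tu)).
  exact: le_trans (nrm_P he _ _) (TPx t).
- rewrite big_cons -/y.
  have -> : y - P t y + \sum_(v <- u :: s) (T (P v x) - P v (T (P v x))) -
      (P u y - P t y + w) = (y - P u y) +
      (\sum_(v <- u :: s) (T (P v x) - P v (T (P v x))) - w).
    by rewrite opprD opprB addrACA !addrA subrK addrAC.
  rewrite (le_trans (nrmD _ _))// -natr1 [in leRHS]addrC mulrDl mul1r.
  by rewrite lerD// tail.
Qed.

(** The summands are [(1 - P u) T P u], one half of the commutator of [T] with [P u]. *)
Definition defect T s : bounded_op H := \sum_(u <- s) (T ** P u - P u ** T ** P u).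

(** With N the length of [s], [staircase] bounds the norm by sqrt N |T| + N d / 2. Any [g] above [f]
    is allowed, so that one sequence can serve both [T] and [star T]. *)
Lemma defect_small T (d : R) : 0 < d -> exists f k,
  forall g s, (forall a, (f a <= g a)%N) -> (k <= size s)%N -> fast_growing g s ->
    nrm (defect T s) <= (size s)%:R * d.
Proof.
move=> d0; have d2 : 0 < d / 2 by lra.
have /choice[f fP] := fun n => column_tail he T n d2.
(* From this length on |T|^2 <= N (d / 2)^2, so sqrt N |T| is at most N d / 2. *)
pose k := Num.bound ((nrm T / (d / 2)) ^+ 2).
exists f, k => g [|t s] fg.
  by move=> _ _; rewrite /defect big_nil nrm0 mul0r.
rewrite /= => ks /andP[_ gs].
apply: nrm_op_le => [|x]; first by rewrite mulr_ge0// ltW.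
have fs : path (fun a b => (a < b) && (f a <= b))%N t s.
  by apply: sub_path gs => a b /andP[-> /=]; exact: leq_trans.
have [w [_ wT wd]] := staircase (fun u m um => fP u m um x) fs.
rewrite bop_sumE -[X in nrm X](subrK w) (le_trans (nrmD _ _))//.
have kT : nrm T ^+ 2 <= (size s).+1%:R * (d / 2) ^+ 2.
  rewrite -ler_pdivrMr ?exprn_gt0// -expr_div_n ltW//.
  rewrite (lt_le_trans (archi_boundP (sqr_ge0 _)))// ler_nat.
  exact: leq_trans ks _.
have wn : nrm w <= (size s).+1%:R * (d / 2) * nrm x.
  have N0 : 0 <= (size s).+1%:R * (d / 2) * nrm x.
    by rewrite mulr_ge0 ?nrm_ge0// mulr_ge0// ltW.
  rewrite -(@ler_pXn2r _ 2) ?nnegrE ?nrm_ge0// (le_trans wT)//.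
  have -> : ((size s).+1%:R * (d / 2) * nrm x) ^+ 2 =
      (size s).+1%:R * ((size s).+1%:R * (d / 2) ^+ 2) * nrm x ^+ 2 by ring.
  by rewrite [in leLHS]exprMn [in leLHS]mulrA ler_wpM2r ?sqr_ge0// ler_wpM2l.
move: wd wn; set N := _.+1%:R; set z := nrm (_ - _); lra.
Qed.

Definition average s : bounded_op H := (size s)%:R^-1%:C%C *: \sum_(u <- s) P u.

Lemma average_commutator T (r : R) : 0 < r -> exists f k,
  forall s, (k <= size s)%N -> fast_growing f s ->
    nrm (T ** average s - average s ** T) <= r.
Proof.
move=> r0; have r2 : 0 < r / 2 by lra.
have [f [k fP]] := defect_small T r2; have [g [l gP]] := defect_small (star T) r2.
(* The 1 makes [s] nonempty, so that its length can be divided by. *)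
exists (fun a => maxn (f a) (g a)), (maxn k (maxn l 1)) => s.
rewrite !geq_max => /andP[ks /andP[ls s1]] fg.
have -> : T ** average s - average s ** T =
    (size s)%:R^-1%:C%C *: (defect T s - star (defect (star T) s)).
  rewrite /average smulZl smulZr -scalerBr; congr (_ *: _).
  rewrite smul_suml smul_sumr /defect star_sum -!sumrB; apply: eq_bigr => u _.
  rewrite starB !starM star_P starK smulA opprB addrA.
  by rewrite subrK.
have n0 : 0 < (size s)%:R :> R by rewrite ltr0n.
rewrite nrmZr ?invr_ge0 ?ler0n// mulrC ler_pdivrMr//.
apply: le_trans (nrmB _ _) _; rewrite nrm_adjoint.
have := fP _ s (fun a => leq_maxl _ _) ks fg.
have := gP _ s (fun a => leq_maxr _ _) ls fg.
lra.
Qed.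

Lemma nrm_average s : nrm (average s) <= 1.
Proof.
apply: nrm_op_le => // x; rewrite mul1r bopZE bop_sumE.
rewrite nrmZr ?invr_ge0 ?ler0n//.
have [->|s0] := posnP (size s); first by rewrite invr0 mul0r nrm_ge0.
rewrite mulrC ler_pdivrMr ?ltr0n// (le_trans (nrm_sum _ _))//.
apply: (@le_trans _ _ (\sum_(u <- s) nrm x)).
  by apply: ler_sum => u _; exact: nrm_P.
by rewrite big_const_seq count_predT iter_addr_0 mulr_natr.
Qed.

(** Together with [average_tail] this gives every such average the eigenvalues 1 and 0, which keeps
    it away from the scalars. *)
Lemma average_head s f : fast_growing f s -> (0 < size s)%N ->
  average s (e 0%N) = e 0%N.
Proof.
move=> fs s0; rewrite bopZE bop_sumE.
have sP u : u \in s -> (0 < u)%N.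
  have tr : transitive ltn by exact: ltn_trans.
  have : path ltn 0 s by apply: sub_path fs => a b /andP[].
  by move/(order_path_min tr)/allP; apply.
rewrite big_seq (eq_bigr (fun=> e 0%N)); last first.
  by move=> u /sP u0; rewrite (P_basis he) u0.
rewrite -big_seq big_const_seq count_predT iter_addr_0 -scalerMnr scalerMnl -mulr_natr.
by rewrite -(rmorph_nat (real_complex R)) -rmorphM mulVf ?scale1r// pnatr_eq0 -lt0n.
Qed.

Lemma average_tail s : exists i, average s (e i) = 0.
Proof.
exists (\max_(u <- s) u); rewrite bopZE bop_sumE big_seq big1 ?scaler0// => u us.
by rewrite (P_basis he) ltnNge leq_bigmax_seq.
Qed.

End FlatCommutant.


(** * Central sequences and their classes in the algebra F *)

Section CentralSequences.
Variables (R : realType) (H : hilbertType R) (V : set_system nat).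
Context {UV : UltraFilter V}.
Local Notation A := (bounded_op H).
Implicit Types (a b : nat -> A) (T : A).

Definition null a := forall r : R, 0 < r -> V [set n | nrm (a n) < r].

Definition central a :=
  linfty A a /\ forall T, null (fun n => T ** a n - a n ** T).

Lemma null_c_set a (la : linfty A a) : null a <-> c_set V (to_subalg la).
Proof.
split=> [na|/c_setP ca r r0].
  apply/c_setP => _ /pos_complexE[r r0 ->].
  by apply: filterS (na _ r0) => n /= an; rewrite nrmE ltcR.
have rC : 0 < r%:C%C by rewrite ltcR.
by apply: filterS (ca _ rC) => n /=; rewrite nrmE ltcR.
Qed.

Lemma quot_pi_eq0 a (la : linfty A a) :
  quot_pi (@c_ideal _ A V _) (to_subalg la) = 0 <-> null a.
Proof.
have -> : 0 = quot_pi (@c_ideal _ A V _) (0 : subalg (linfty A)).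
  by rewrite -[in RHS](scale0r (0 : subalg (linfty A))) quot_piZ scale0r.
by rewrite quot_piP subr0 (null_c_set la).
Qed.

Lemma central_commutant a (la : linfty A a) :
  (forall T, null (fun n => T ** a n - a n ** T)) <->
  commutant_set (constants A V) (quot_pi (@c_ideal _ A V _) (to_subalg la)).
Proof.
have E T : null (fun n => T ** a n - a n ** T) <->
    @diag _ _ V _ T ** quot_pi (@c_ideal _ A V _) (to_subalg la) =
    quot_pi (@c_ideal _ A V _) (to_subalg la) ** @diag _ _ V _ T.
  rewrite /diag -!quot_piM quot_piP.
  set b := (X in c_ideal _ X).
  have lb : linfty A (fun n => T ** a n - a n ** T) := subalgP b.
  by rewrite (null_c_set lb); have -> : to_subalg lb = b by exact: val_inj.
split=> [ca _ [T _ <-]|ca T]; first exact/E.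
by apply/E/ca; exists T.
Qed.

Definition F_class a (ca : central a) : F_algebra A V :=
  quot_pi (annihilator (constants A V))
    (to_subalg (B := commutant (constants A V)) (proj1 (central_commutant (proj1 ca)) (proj2 ca))).

Lemma F_class_surj (x : F_algebra A V) : exists a (ca : central a), x = F_class ca.
Proof.
have [y <-] := quot_pi_surj x; have [w wy] := quot_pi_surj (val y).
pose a : nat -> A := val w.
have la : linfty A a := subalgP w.
have law : to_subalg la = w by exact: val_inj.
have ca : central a.
  split=> //; apply/(central_commutant la); rewrite law wy.
  exact: (subalgP y).
exists a, ca; congr quot_pi; apply: val_inj; rewrite /= -wy.
by congr quot_pi; exact: val_inj.
Qed.

(** There is an identity operator, so the annihilator of the constants is trivial and relations in F
    are relations modulo null sequences. *)
Lemma F_class_dependent a b (ca : central a) (cb : central b) (c d : R[i]) :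
  c *: F_class ca + d *: F_class cb = 0 <-> null (fun n => c *: a n + d *: b n).
Proof.
have lab : linfty A (fun n => c *: a n + d *: b n).
  have lb : linfty A (d *: b).
    have := linftyD d cb.1 (linfty0 A).
    by rewrite addr0.
  exact: (linftyD c ca.1 lb).
rewrite -(quot_pi_eq0 lab) /F_class -!quot_piZ -quot_piD.
set y := _ + _.
have yE : val y = quot_pi (@c_ideal _ A V _) (to_subalg lab).
  rewrite /= -!quot_piZ -quot_piD; congr quot_pi; exact: val_inj.
have z0 : 0 = quot_pi (annihilator (constants A V)) 0.
  by rewrite -[in RHS](scale0r (0 : subalg (commutant (constants A V))))
    quot_piZ scale0r.
rewrite z0 quot_piP subr0; split=> [ny|y0 t _]; last by rewrite yE y0 smul0l.
(* Multiplying by the constant identity turns annihilation into vanishing. *)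
have := ny (@diag _ _ V _ (id_op H)); rewrite yE => <-; last by exists (id_op H).
rewrite /diag -quot_piM; congr quot_pi; apply: val_inj.
by apply/funext => n; exact: bop_ext.
Qed.

Lemma central_id : central (fun=> id_op H).
Proof.
split=> [|T r r0]; first by exists `|id_op H|.
apply: filterS filterT => n _ /=.
by rewrite (_ : _ - _ = 0) ?nrm0//; apply: bop_ext => x; rewrite bopBE subrr.
Qed.

End CentralSequences.

(** The two independent elements are the class of the averages and that of the identity. *)
Lemma F_flat (R : realType) (H : hilbertType R) (e : nat -> H)
    (U : set_system nat) (UU : UltraFilter U) : orthonormal_basis e ->
    (forall f k, U [set n | (k <= size (seq_of n))%N /\ fast_growing f (seq_of n)]) ->
  exists x y : F_algebra (bounded_op H) U,
    forall c d : R[i], c *: x + d *: y = 0 -> c = 0 /\ d = 0.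
Proof.
move=> he Uflat; pose a n : bounded_op H := average e (seq_of n).
have ca : central U a.
  split=> [|T r r0]; first by exists 1 => n; rewrite nrmE lecR nrm_average.
  have r2 : 0 < r / 2 by lra.
  have [f [k fP]] := average_commutator he T r2.
  apply: filterS (Uflat f k) => n [kn fn] /=.
  by rewrite (le_lt_trans (fP _ kn fn))//; lra.
exists (F_class ca), (F_class (central_id H (V := U))) => c d /F_class_dependent cd.
have small (r : R) : 0 < r -> exists s, [/\ (0 < size s)%N, fast_growing id s &
    nrm (c *: average e s + d *: id_op H) < r].
  move=> r0; have [n [[s1 fs] an]] := filter_ex (filterI (Uflat id 1%N) (cd r r0)).
  by exists (seq_of n).
have eq0 (z : R[i]) : (forall r : R, 0 < r -> cnorm z < r) -> z = 0.
  move=> zr; apply/cnorm_eq0/eqP; rewrite eq_le cnorm_ge0 andbT leNgt.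
  by apply/negP => /[dup] z0 /zr; rewrite ltxx.
(* The combination has eigenvalue [c + d] at [e 0], and [d] at a basis vector killed by the
   average. *)
have cd0 : c + d = 0.
  apply: eq0 => r /small[s [s1 fs]]; apply: le_lt_trans.
  have := nrm_op (c *: average e s + d *: id_op H) (e 0%N).
  rewrite bopDE (bopZE c) (bopZE d) (average_head he fs)// id_opE -scalerDl nrmZ.
  by rewrite (nrm_basis he) !mulr1.
have d0 : d = 0.
  apply: eq0 => r /small[s [s1 fs]]; apply: le_lt_trans.
  have [i si] := average_tail he s.
  have := nrm_op (c *: average e s + d *: id_op H) (e i).
  rewrite bopDE (bopZE c) (bopZE d) si id_opE scaler0 add0r nrmZ.
  by rewrite (nrm_basis he) !mulr1.
by move: cd0; rewrite d0 addr0.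
Qed.


(** * Triviality of the commutant for selective ultrafilters *)

Section UltraLimits.
Variables (V : set_system nat).
Context {UV : UltraFilter V}.

Lemma nonprincipal_tail k : nonprincipal V -> V [set n | (k <= n)%N].
Proof.
move=> npV; elim: k => [|k IH]; first by apply: filterS filterT.
have [/npV//|Vk] := in_ultra_setVsetC [set k] UV.
apply: filterS (filterI IH Vk) => n [/= kn nk].
by rewrite ltn_neqAle kn andbT; apply/eqP => /esym.
Qed.

(** The limit is the supremum of the [t] that [x] reaches on a set in [V]. *)
Lemma ultralimit_real (R : realType) (x : nat -> R) (M : R) :
  (forall n, `|x n| <= M) ->
  exists l, forall r, 0 < r -> V [set n | `|x n - l| < r].
Proof.
move=> xM; pose S := [set t | V [set n | t <= x n]].
have S0 : S (- M).
  by apply: filterS filterT => n _ /=; have := xM n; rewrite ler_norml => /andP[].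
have SM : ubound S M.
  move=> t /filter_ex[n /= tx]; apply: le_trans tx _.
  by have := xM n; rewrite ler_norml => /andP[].
have hS : has_sup S by split; [exists (- M)|exists M].
exists (sup S) => r r0; have [t St tl] := sup_adherent r0 hS.
have [Sr|nSr] := in_ultra_setVsetC [set n | sup S + r / 2 <= x n] UV.
  have /(_ _ Sr) := ub_le_sup hS.2.
  by rewrite gerDl leNgt divr_gt0.
apply: filterS (filterI St nSr) => n [/= tx /negP]; rewrite -ltNge => xs.
by rewrite ltr_norml; apply/andP; split; lra.
Qed.

Variable R : realType.
Implicit Types (z w : nat -> R[i]) (l m c : R[i]).

Lemma cnormD l m : cnorm (l + m) <= cnorm l + cnorm m.
Proof. by rewrite -lecR rmorphD /= -!cnormE ler_normD. Qed.

Lemma cnormM l m : cnorm (l * m) = cnorm l * cnorm m.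
Proof. by apply/complexI; rewrite rmorphM /= -!cnormE normrM. Qed.

Lemma cnormN l : cnorm (- l) = cnorm l.
Proof. by rewrite /cnorm normrN. Qed.

Lemma cnorm_sqr l : cnorm l ^+ 2 = complex.Re l ^+ 2 + complex.Im l ^+ 2.
Proof. by apply/complexI; rewrite add_Re2_Im2 cnormE rmorphXn. Qed.

Definition ultra_cvg z l := forall r : R, 0 < r -> V [set n | cnorm (z n - l) < r].

Lemma ultralimit z (M : R) : (forall n, cnorm (z n) <= M) -> exists l, ultra_cvg z l.
Proof.
move=> zM.
have part (u : R) n : u ^+ 2 <= cnorm (z n) ^+ 2 -> `|u| <= M.
  move=> uz; apply: le_trans (zM n).
  by rewrite -(@ler_pXn2r _ 2) ?nnegrE ?cnorm_ge0// real_normK ?num_real.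
have [a aP] : exists t : R, forall r : R, 0 < r -> V [set n | `|complex.Re (z n) - t| < r].
  apply: (@ultralimit_real R _ M) => n; apply: (part _ n).
  by rewrite cnorm_sqr lerDl sqr_ge0.
have [b bP] : exists t : R, forall r : R, 0 < r -> V [set n | `|complex.Im (z n) - t| < r].
  apply: (@ultralimit_real R _ M) => n; apply: (part _ n).
  by rewrite cnorm_sqr lerDr sqr_ge0.
exists (a +i* b)%C => r r0; have r2 : 0 < r / 2 by lra.
apply: filterS (filterI (aP _ r2) (bP _ r2)) => n [/= ar br].
rewrite -(@ltr_pXn2r _ 2) ?nnegrE ?cnorm_ge0 ?(ltW r0)// cnorm_sqr.
case: (z n) ar br => u v /=; rewrite !ltr_norml => /andP[u1 u2] /andP[v1 v2].
nra.
Qed.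

Lemma ultra_cvg_unique z l m : ultra_cvg z l -> ultra_cvg z m -> l = m.
Proof.
move=> zl zm; apply/eqP; rewrite -subr_eq0; apply/eqP/cnorm_eq0/eqP.
rewrite eq_le cnorm_ge0 andbT leNgt; apply/negP => lm.
have lm2 : 0 < cnorm (l - m) / 2 by lra.
have [n [/= zln zmn]] := filter_ex (filterI (zl _ lm2) (zm _ lm2)).
have : l - m = (z n - m) + - (z n - l) by rewrite opprB [RHS]addrC addrA subrK.
move=> /(congr1 (@cnorm R)) E.
have := cnormD (z n - m) (- (z n - l)); rewrite -E cnormN; lra.
Qed.

Lemma ultra_cvg_lin z w l m c : ultra_cvg z l -> ultra_cvg w m ->
  ultra_cvg (fun n => c * z n + w n) (c * l + m).
Proof.
move=> zl wm r r0; have c1 : 0 < cnorm c + 1 by have := cnorm_ge0 c; lra.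
have r2 : 0 < r / 2 by lra.
have r3 : 0 < r / 2 / (cnorm c + 1) by rewrite divr_gt0.
apply: filterS (filterI (zl _ r3) (wm _ r2)) => n [/=].
rewrite ltr_pdivlMr// => zn wn.
rewrite opprD addrACA -mulrBr (le_lt_trans (cnormD _ _))// cnormM.
have := cnorm_ge0 c; have := cnorm_ge0 (z n - l); nra.
Qed.

Lemma ultra_cvg_le z l (M : R) : (forall n, cnorm (z n) <= M) -> ultra_cvg z l ->
  cnorm l <= M.
Proof.
move=> zM zl; apply/ler_addgt0Pr => r r0; have [n /= zn] := filter_ex (zl r r0).
have := cnormD (z n) (- (z n - l)); rewrite cnormN opprB addrC subrK.
by have := zM n; lra.
Qed.

Lemma ultra_cvg_near z l : V [set n | z n = l] -> ultra_cvg z l.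
Proof.
by move=> zl r r0; apply: filterS zl => n /= ->; rewrite subrr /cnorm normr0.
Qed.

(** The limits of the coefficients form a bounded sesquilinear form, which the Riesz theorem turns
    into an operator. *)
Lemma weak_ultralimit (H : hilbertType R) (S : nat -> bounded_op H) (M : R) :
    (forall n, nrm (S n) <= M) ->
  exists T : bounded_op H, nrm T <= M /\
    forall x y, ultra_cvg (fun n => inner (S n x) y) (inner (T x) y).
Proof.
move=> SM; have M0 : 0 <= M by exact: le_trans (nrm_ge0 _) (SM 0%N).
have bnd x y n : cnorm (inner (S n x) y) <= M * nrm x * nrm y.
  rewrite (le_trans (nrm_CS _ _))// ler_wpM2r ?nrm_ge0//.
  by rewrite (le_trans (nrm_op _ _))// ler_wpM2r ?nrm_ge0.
have /choice[f fP] : forall p : H * H, exists l,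
    ultra_cvg (fun n => inner (S n p.1) p.2) l.
  by move=> [x y]; exact: ultralimit (bnd x y).
have {}fP x y : ultra_cvg (fun n => inner (S n x) y) (f (x, y)) by exact: (fP (x, y)).
have fbnd x y : cnorm (f (x, y)) <= M * nrm x * nrm y.
  exact: ultra_cvg_le (bnd x y) (fP x y).
(* Riesz represents the form in its first variable, so [A] is the adjoint of the operator sought. *)
have /choice[A AP] : forall y, exists z : H, forall x, f (x, y) = inner x z.
  move=> y; apply: (@riesz _ _ (fun x => f (x, y)) (M * nrm y)) => [c x x'|x].
    apply: ultra_cvg_unique (fP _ _) _.
    have -> : (fun n => inner (S n (c *: x + x')) y) =
        (fun n => c * inner (S n x) y + inner (S n x') y).
      by apply/funext => n; rewrite bop_linear innerDl innerZl.
    by apply: ultra_cvg_lin; exact: fP.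
  by rewrite cnormE nrmE -rmorphM lecR mulrAC.
have Alin : linear A.
  move=> c y y'; apply: inner_inj => x; rewrite innerDr innerZr -!AP.
  apply: ultra_cvg_unique (fP _ _) _.
  have -> : (fun n => inner (S n x) (c *: y + y')) =
      (fun n => c^* * inner (S n x) y + inner (S n x) y').
    by apply/funext => n; rewrite innerDr innerZr.
  by apply: ultra_cvg_lin; exact: fP.
have Abnd y : nrm (A y) <= M * nrm y.
  have [Ay|Ay] := eqVneq (nrm (A y)) 0; first by rewrite Ay mulr_ge0 ?nrm_ge0.
  have Ay0 : 0 < nrm (A y) by rewrite lt_def Ay nrm_ge0.
  rewrite -(ler_pM2r Ay0) -expr2 mulrAC.
  have := fbnd (A y) y; rewrite AP inner_nrm.
  by rewrite /cnorm ger0_norm// ler0c exprn_ge0 ?nrm_ge0.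
have Abl : A \in @bounded_linear R H.
  apply/asboolP; split=> //; exists M%:C%C => y.
  by rewrite !nrmE -rmorphM lecR.
pose T := star (BoundedOp Abl); exists T; split=> [|x y].
  by rewrite nrm_adjoint; exact: nrm_op_le.
have -> : inner (T x) y = f (x, y); last exact: fP.
have aT : adjoint T = BoundedOp Abl by exact: starK.
by rewrite AP adjointP aT.
Qed.

End UltraLimits.


(** The finite sums [S N] are contractions by Pythagoras. Their weak limit along [V] takes the right
    values because [S N (e i)] is constant for [N > i]. *)
Lemma orthogonal_extension (R : realType) (H : hilbertType R) (e v : nat -> H)
    (V : set_system nat) {UV : UltraFilter V} : nonprincipal V ->
    orthonormal_basis e -> (forall i, nrm (v i) <= 1) ->
    (forall i j, (i < j)%N -> inner (v i) (v j) = 0) ->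
  exists S : bounded_op H, nrm S <= 1 /\ forall i, S (e i) = v i.
Proof.
move=> npV he v1 vv; pose S N : bounded_op H := \sum_(j < N) rank1 (v j) (e j).
have SE N x : S N x = \sum_(j < N) inner x (e j) *: v j by rewrite bop_sumE.
have Srec N x : S N.+1 x = S N x + inner x (e N) *: v N by rewrite !SE big_ord_recr.
have SP N x : nrm (S N x) ^+ 2 <= nrm (P e N x) ^+ 2.
  elim: N => [|N IH]; first by rewrite SE PE !big_ord0.
  rewrite Srec (P_rec e) !pythagoras.
  - rewrite lerD// !nrmZ (nrm_basis he) mulr1 lerXn2r ?nnegrE ?mulr_ge0 ?cnorm_ge0 ?nrm_ge0//.
    by rewrite ler_piMr ?cnorm_ge0.
  - by rewrite innerZr (inner_P he) ltnn mulr0.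
  - by rewrite innerZr SE inner_suml big1 ?mulr0// => j _; rewrite innerZl vv ?mulr0.
have S1 N : nrm (S N) <= 1.
  apply: nrm_op_le => // x; rewrite mul1r; apply: le_trans (nrm_P he N x).
  by rewrite -(@ler_pXn2r _ 2) ?nnegrE ?nrm_ge0.
have Se N i : (i < N)%N -> S N (e i) = v i.
  move=> iN; rewrite SE (bigD1 (Ordinal iN))//= (basis_inner he) eqxx scale1r.
  rewrite big1 ?addr0// => j ji; rewrite (basis_inner he) (_ : _ == _ = false) ?scale0r//.
  by apply/eqP => ij; move/eqP: ji; apply; apply: val_inj.
have [T [T1 TP]] := weak_ultralimit S1; exists T; split=> // i.
apply: inner_inj => y; rewrite innerC [RHS]innerC; congr (_^*%R).
apply: ultra_cvg_unique (TP (e i) y) _; apply: ultra_cvg_near.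
by apply: filterS (nonprincipal_tail i.+1 npV) => n /= iN; rewrite Se.
Qed.

(** Upgrades columnwise convergence to norm convergence. Selectivity lets a single operator [S] test
    the commutator at all indices of a set in [V], one block for each. *)
Lemma selective_blocks (R : realType) (H : hilbertType R) (e : nat -> H)
    (V : set_system nat) {UV : UltraFilter V} (b : nat -> bounded_op H) :
    nonprincipal V -> selective V -> orthonormal_basis e ->
    (forall T : bounded_op H, null V (fun n => T ** b n - b n ** T)) ->
    (forall j, null V (fun n => b n ** rank1 (e j) (e j))) ->
  null V b.
Proof.
move=> npV selV he bcomm bcol r r0; apply: contrapT => nsmall.
have {nsmall}big : V [set n | r <= nrm (b n)].
  have [//|Vc] := in_ultra_setVsetC [set n | nrm (b n) < r] UV.
  by apply: filterS Vc => n /= /negP; rewrite -leNgt.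
have bP k (d : R) : 0 < d -> V [set n | forall x, nrm (b n (P e k x)) <= d * nrm x].
  elim: k d => [|k IH] d d0.
    apply: filterS filterT => n _ x; rewrite PE big_ord0 bop0 nrm0.
    by rewrite mulr_ge0 ?nrm_ge0// ltW.
  have d2 : 0 < d / 2 by lra.
  apply: filterS (filterI (IH _ d2) (bcol k _ d2)) => n [/= bk bek] x.
  rewrite P_rec bopD (le_trans (nrmD _ _))//.
  have := nrm_op (b n ** rank1 (e k) (e k)) x; rewrite bopME rank1E.
  have := bk x; have := nrm_ge0 x; nra.
(* [zs] pairs a vector with a bound on its support; it is zero by default where |b_n| < r. *)
have /choice[zs zsP] : forall n, exists zs : H * nat,
    [/\ nrm zs.1 <= 1, P e zs.2 zs.1 = zs.1
      & r <= nrm (b n) -> r / 2 <= nrm (b n zs.1)].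
  move=> n; have [rb|nrb] := pselect (r <= nrm (b n)); last first.
    by exists (0, 0%N); rewrite /= nrm0 bop0; split.
  (* The factor 3 / 4 leaves a loss of r / 4 for the truncation to finite support. *)
  have [x xP] : exists x, 3 / 4 * r * nrm x < nrm (b n x).
    apply: contrapT => /forallNP nx; suff : nrm (b n) <= 3 / 4 * r by lra.
    apply: nrm_op_le => [|x]; first by lra.
    by rewrite leNgt; apply/negP; exact: nx.
  have x0 : 0 < nrm x.
    rewrite lt_def nrm_ge0 andbT; apply/eqP => /nrm_eq0 x0.
    by move: xP; rewrite x0 bop0 nrm0 mulr0 ltxx.
  pose z := (nrm x)^-1%:C%C *: x.
  have nz (y : H) : nrm ((nrm x)^-1%:C%C *: y) = nrm y / nrm x :> R.
    by rewrite nrmZr ?invr_ge0 ?nrm_ge0// mulrC.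
  have z1 : nrm z = 1 by rewrite nz// divff ?gt_eqF.
  have bz : 3 / 4 * r < nrm (b n z) by rewrite bopZ nz// ltr_pdivlMr.
  have B1 : 0 < nrm (b n) + 1 by have := nrm_ge0 (b n); lra.
  have [N /(_ N (leqnn _)) NP] := P_cvg he z (divr_gt0 (divr_gt0 r0 (ltr0n _ 4)) B1).
  exists (P e N z, N) => /=; split.
  - by rewrite -z1 (nrm_P he).
  - by rewrite (PP he) minnn.
  - move=> _; have := nrm_op (b n) (z - P e N z); rewrite bopB.
    have := nrmD (b n z - b n (P e N z)) (b n (P e N z)); rewrite subrK.
    have : nrm (b n) * nrm (z - P e N z) <= (nrm (b n) + 1) * (r / 4 / (nrm (b n) + 1)).
      by apply: ler_pM; rewrite ?nrm_ge0// lerDl.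
    rewrite [X in _ <= X -> _]mulrC divfK ?gt_eqF//.
    lra.
(* [q n] bounds the supports of all vectors up to index [n]; the summand [n.+1] ensures that [e i]
   is among the first [q (y i)] basis vectors. *)
pose q n := (n.+1 + \sum_(k < n.+1) (zs k).2)%N.
have qS n : (q n <= q n.+1)%N.
  by rewrite leq_add// [leqRHS]big_ord_recr leq_addr.
have qmono : {homo q : i j / (i <= j)%N}.
  by apply: homo_leq qS => [//|]; exact: leq_trans.
have qz n : ((zs n).2 <= q n)%N.
  by rewrite /q big_ord_recr /= addnA leq_addl.
have qn n : (n < q n)%N by rewrite /q addSn ltnS leq_addr.
pose A m := [set n | r <= nrm (b n) /\ forall x, nrm (b n (P e (q m) x)) <= r / 8 * nrm x].
have VA m : V (A m).
  have r8 : 0 < r / 8 by lra.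
  exact: filterS (filterI big (bP (q m) _ r8)).
have [X VX [y [yS XE yA]]] := selV A VA.
have [yk ymono] := increasing_le yS.
pose z n := (zs n).1.
(* [v i] lives on the coordinates from [q (y i)] up to [q (y i.+1)], and these blocks are
   disjoint. *)
pose v i := z (y i.+1) - P e (q (y i)) (z (y i.+1)).
have vl i : P e (q (y i)) (v i) = 0 by rewrite bopB (PP he) minnn subrr.
have vu i : P e (q (y i.+1)) (v i) = v i.
  rewrite bopB (PP he) (minn_idPr (qmono _ _ (ltnW (yS i)))); congr (_ - _).
  have [_ zE _] := zsP (y i.+1).
  by rewrite /z -zE (PP he) (minn_idPr (qz _)).
have v1 i : nrm (v i) <= 1.
  by rewrite (le_trans (nrm_subP he _ _))//; have [] := zsP (y i.+1).
have vv i j : (i < j)%N -> inner (v i) (v j) = 0.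
  move=> ij; rewrite -(vu i); apply: (P_orth he _ _ (vl j)).
  exact/qmono/ymono.
have [S [S1 Se]] := orthogonal_extension npV he v1 vv.
(* At n = [y i.+1], |b_n v_i| >= r/2 - r/8 and |S b_n e_i| <= r/8, so the commutator has norm at
   least r / 4. *)
have r4 : 0 < r / 4 by lra.
have [n [[Xn yn] /=]] := filter_ex
  (filterI (filterI VX (nonprincipal_tail (y 0%N).+1 npV)) (bcomm S _ r4)).
(* The index found is beyond [y 0], so it is some [y i.+1] and lies in [A (y i)]. *)
move: Xn yn; rewrite XE => -[[|i] _ <-] /=; first by rewrite ltnn.
move=> _; apply/negP; rewrite -leNgt.
have [rb small] := yA i; have [z1 _ /(_ rb) zb] := zsP (y i.+1).
have := nrm_op (S ** b (y i.+1) - b (y i.+1) ** S) (e i).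
rewrite bopBE !bopME Se (nrm_basis he) mulr1.
have := nrmB (S (b (y i.+1) (e i))) (S (b (y i.+1) (e i)) - b (y i.+1) (v i)).
rewrite subKr /v bopB.
have bei : nrm (b (y i.+1) (e i)) <= r / 8.
  have := small (e i); rewrite (P_basis he) (nrm_basis he) mulr1.
  by rewrite (leq_ltn_trans (yk i) (qn _)).
have := nrm_op S (b (y i.+1) (e i)).
have := nrmD (b (y i.+1) (z (y i.+1)) - b (y i.+1) (P e (q (y i)) (z (y i.+1))))
  (b (y i.+1) (P e (q (y i)) (z (y i.+1)))); rewrite subrK.
have := small (z (y i.+1)); move: zb z1; rewrite -/(z _).
have : nrm S * nrm (b (y i.+1) (e i)) <= 1 * (r / 8).
  by apply: ler_pM; rewrite ?nrm_ge0.
have := nrm_ge0 (z (y i.+1)).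
set n1 := nrm (z _); set n2 := nrm S * _; move=> *.
have : r / 8 * n1 <= r / 8 by rewrite ler_piMr//; lra.
lra.
Qed.


(** [u] is the class of the identity, and the scalar is the limit of the coefficient of [a n] at
    [e 0]. *)
Lemma F_selective (R : realType) (H : hilbertType R) (e : nat -> H)
    (V : set_system nat) (UV : UltraFilter V) :
    nonprincipal V -> selective V -> orthonormal_basis e ->
  exists u : F_algebra (bounded_op H) V,
    forall x, exists c : R[i], x = c *: u.
Proof.
move=> npV selV he; exists (F_class (central_id H (V := V))) => x.
have [a [ca ->]] := F_class_surj x.
have [M aM] : exists M : R, forall n, nrm (a n) <= M.
  have [M aM] := ca.1; exists (complex.Re M) => n.
  have M0 : 0 <= M by apply: le_trans (aM 0%N).
  by rewrite -lecR -nrmE RRe_real// ger0_real.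
have [l al] : exists l, ultra_cvg V (fun n => inner (a n (e 0%N)) (e 0%N)) l.
  apply: (@ultralimit V _ R _ M) => n; apply: le_trans (nrm_CS _ _) _.
  by rewrite (nrm_basis he) mulr1 (le_trans (nrm_op _ _))// (nrm_basis he) mulr1.
exists l; apply/eqP; rewrite -subr_eq0 -scaleNr -[F_class ca]scale1r; apply/eqP.
apply/(F_class_dependent ca); apply: (selective_blocks npV selV he) => [T r r0|j r r0].
  apply: filterS (ca.2 T r r0) => n /=; congr (nrm _ < r); apply: bop_ext => z.
  by rewrite !bopE !id_opE bopD !bopZ !scale1r opprD addrACA subrr addr0.
have r2 : 0 < r / 2 by lra.
(* Almost commuting with the operator that sends [e 0] to [e j] forces [a n (e j)] to be close to
   the coefficient at [e 0] times [e j]. *)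
apply: filterS (filterI (al _ r2) (ca.2 (rank1 (e j) (e 0%N)) _ r2)) => n [/= lr Tr].
set b := 1 *: a n + - l *: id_op H.
have bej : nrm (b (e j)) < r.
  have := nrm_op (rank1 (e j) (e 0%N) ** a n - a n ** rank1 (e j) (e 0%N)) (e 0%N).
  rewrite bopBE !bopME !rank1E (basis_inner he) eqxx bopZ scale1r (nrm_basis he) mulr1.
  set c := inner _ _ in lr * => Tr'.
  have -> : b (e j) = (c - l) *: e j - (c *: e j - a n (e j)).
    by rewrite /b !bopE id_opE scale1r scalerBl scaleNr opprB [RHS]addrC addrA subrK.
  rewrite (le_lt_trans (nrmB _ _))// nrmZ (nrm_basis he) mulr1.
  lra.
apply: le_lt_trans bej; apply: nrm_op_le => [|z]; first exact: nrm_ge0.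
rewrite bopME rank1E bopZ nrmZ mulrC ler_wpM2l ?nrm_ge0//.
by rewrite (le_trans (nrm_CS _ _))// (nrm_basis he) mulr1.
Qed.

(** A linear bijection preserves independence, but the first algebra has two independent elements
    while the second is spanned by one. *)
Theorem corollary3 (R : realType) (H : hilbertType R)
    (sepH : separable_space H) (infH : infinite_dimensional H)
    (CH : continuum_hypothesis) :
  exists (U V : set_system nat) (UU : UltraFilter U) (UV : UltraFilter V),
    [/\ nonprincipal U, nonprincipal V
      & ~ star_isomorphic (F_algebra (bounded_op H) U)
                          (F_algebra (bounded_op H) V)].
Proof.
have [e he] := Gram_Schmidt sepH infH.
have [U [UU npU Uflat]] := flat_ultrafilter.
have [V [UV npV selV]] := selective_ultrafilter CH.
exists U, V, UU, UV; split=> // -[f [/bij_inj finj flin _ _]].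
have [x [y xy]] := F_flat UU he Uflat.
have [u uP] := F_selective UV npV selV he.
have f0 : f 0 = 0.
  by have := flin (-1) 0 0; rewrite scaler0 addr0 scaleN1r addNr.
have fZ c z : f (c *: z) = c *: f z by have := flin c z 0; rewrite f0 !addr0.
have [c fx] := uP (f x); have [d fy] := uP (f y).
(* As [f x = c *: u] and [f y = d *: u], [f] kills [d *: x - c *: y]; then [d = 0] leaves [f y = 0],
   a second relation. *)
have [d0 _] : d = 0 /\ - c = 0.
  by apply: xy; apply: finj; rewrite flin fZ fx fy !scalerA -scalerDl f0 mulrC
    mulNr subrr scale0r.
have [_ /eqP] : 0 = 0 :> R[i] /\ 1 = 0 :> R[i].
  by apply: xy; apply: finj; rewrite flin fZ fy d0 f0 !scale0r scaler0 addr0.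
by rewrite oner_eq0.
Qed.
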